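(* Let $\mathcal{L}$ be a $\mathcal{J}$-subspace lattice on a Banach space $X$ over the real or complex field $\mathbb{F}$, and let $\mathrm{Alg}\mathcal{L}$ be the associated $\mathcal{J}$-subspace lattice algebra. Let $\{L_n\}_{n=0}^{\infty}$ be a family of linear mappings $L_n:\mathrm{Alg}\mathcal{L}\to \mathrm{Alg}\mathcal{L}$ with $L_0=\mathrm{id}$. Then $$L_n([A,B])=\sum_{i+j=n}[L_i(A),L_j(B)]$$ holds for every $n\ge 0$ and all $A,B\in \mathrm{Alg}\mathcal{L}$ with $AB=0$ if and only if for each $K\in\mathcal{J}(\mathcal{L})$ there exist a sequence $\mathbf{T}_K=(T_{Kn})_{n\ge 1}$ in $\mathcal{B}(K)$, with associated family of linear mappings $\{\Delta(\mathbf{T})_{Kn}\}_{n=1}^{\infty}$, and a sequence of linear functionals $h_{Kn}:\mathrm{Alg}\mathcal{L}\to\mathbb{F}$ $(n\ge 1)$ satisfying $h_{Kn}([A,B])=0$ for all $A,B\in\mathrm{Alg}\mathcal{L}$ with $AB=0$, such that $$L_n(A)x=\bigl(\Delta(\mathbf{T})_{Kn}(A)+h_{Kn}(A)I\bigr)x$$ for all $n\ge 1$, all $A\in \mathrm{Alg}\mathcal{L}$ and all $x\in K$.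
   Context: Subspaces in a lattice are closed. A family $\mathcal{L}$ of subspaces of a Banach space $X$ is a subspace lattice if it contains $\{0\}$ and $X$ and is closed under arbitrary closed linear spans $\bigvee$ and intersections $\bigwedge$. $\mathrm{Alg}\mathcal{L}$ is the algebra of all bounded linear operators on $X$ leaving every subspace in $\mathcal{L}$ invariant. For $K\in\mathcal{L}$ put $K_-=\bigvee\{L\in\mathcal{L}: K\nsubseteq L\}$, and let $\mathcal{J}(\mathcal{L})=\{K\in\mathcal{L}: K\ne\{0\}\text{ and }K_-\ne X\}$. $\mathcal{L}$ is a $\mathcal{J}$-subspace lattice if: (1) $\bigvee\{K: K\in\mathcal{J}(\mathcal{L})\}=X$; (2) $\bigwedge\{K_-: K\in\mathcal{J}(\mathcal{L})\}=\{0\}$; (3) $K\bigvee K_-=X$ for each $K\in\mathcal{J}(\mathcal{L})$; (4) $K\bigwedge K_-=\{0\}$ for each $K\in\mathcal{J}(\mathcal{L})$. Then $\mathrm{Alg}\mathcal{L}$ is called a $\mathcal{J}$-subspace lattice algebra. $[A,B]=AB-BA$. $\mathcal{B}(K)$ is the algebra of bounded linear operators on $K$. For an element $a$ of an associative algebra and an integer $k\ge1$, define the sequence of mappings $[a,k]=([a,k]_n)_{n\ge 0}$ by $[a,k]_0(x)=x$; $[a,k]_n(x)=0$ if $k\nmid n$; and $[a,k]_n(x)=a^rx-a^{r-1}xa$ if $n=kr\neq 0$. For sequences of mappings $d=(d_n)$, $d'=(d'_n)$, define $(d*d')_n=\sum_{i+j=n}d_i\circ d'_j$. For a sequence $\mathbf{T}_K=(T_{Kn})_{n\ge1}$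 in $\mathcal{B}(K)$, set $$\Delta(\mathbf{T})_{Kn}=\bigl([T_{K1},1]*[T_{K2},2]*\cdots*[T_{Kn},n]\bigr)_n .$$ For $A\in\mathrm{Alg}\mathcal{L}$, which leaves $K$ invariant, $\Delta(\mathbf{T})_{Kn}(A)$ denotes the operator on $K$ obtained by applying this mapping to the restriction $A|_K\in\mathcal{B}(K)$. For example, $\Delta(\mathbf{T})_{K1}(A)=T_{K1}A-AT_{K1}$ and $\Delta(\mathbf{T})_{K2}(A)=T_{K1}^2A-T_{K1}AT_{K1}+T_{K2}A-AT_{K2}$ on $K$. *)

(* Defs.v *)
From HB Require Import structures.
From mathcomp Require Import all_boot all_order all_algebra.
From mathcomp Require Import all_classical all_reals all_analysis.
From mathcomp Require Import complex.

Set Implicit Arguments.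
Unset Strict Implicit.
Unset Printing Implicit Defensive.

Import Order.TTheory GRing.Theory Num.Theory.
Import numFieldNormedType.Exports.

Local Open Scope classical_set_scope.
Local Open Scope ring_scope.

Section ClosedSubspace.
Context {F : numFieldType} {X : normedModType F}.

Definition is_closed_subspace (K : set X) : Prop :=
  [/\ K 0, forall (a : F) x y, K x -> K y -> K (a *: x + y) & closed K].

Record csubspace := CSubspace {
  csset :> set X ;
  _ : is_closed_subspace csset
}.

Implicit Types K M : csubspace.

Lemma csubspaceP K : is_closed_subspace K. Proof. by case: K. Qed.

Lemma csubspace_inj K M : csset K = csset M -> K = M.
Proof.
case: K M => [K hK] [M hM] /= eKM; move: hK hM; rewrite eKM => hK hM.
by congr CSubspace; exact: Prop_irrelevance.
Qed.

Definition linear_span (A : set X) : set X :=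
  [set x | exists s : seq (F * X),
    (forall p, p \in s -> A p.2) /\ x = \sum_(p <- s) p.1 *: p.2].

Lemma linear_spanP (A : set X) (a : F) (x y : X) :
  linear_span A x -> linear_span A y -> linear_span A (a *: x + y).
Proof.
move=> [s [sA ->]] [t [tA ->]].
exists ([seq (a * p.1, p.2) | p <- s] ++ t); split.
  by move=> p; rewrite mem_cat => /orP[/mapP[q qs ->]/=|]; [exact: sA|exact: tA].
rewrite big_cat big_map scaler_sumr; congr (_ + _).
by apply: eq_bigr => p _; rewrite scalerA.
Qed.

Lemma closed_span_subproof (A : set X) :
  is_closed_subspace (closure (linear_span A)).
Proof.
split; last exact: closed_closure.
  apply: subset_closure; exists [::]; split=> //.
  by rewrite big_nil.
move=> a x y Ax Ay B nB.
have cadd : continuous (fun z : X * X => a *: z.1 + z.2).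
  move=> z; apply: cvgD; last exact: cvg_snd.
  by apply: cvgZl_tmp; exact: cvg_fst.
have /= [[U V] [nU nV] UVB] := cadd (x, y) _ nB.
have [u [Au Uu]] := Ax _ nU; have [v [Av Vv]] := Ay _ nV.
exists (a *: u + v); split; first exact: linear_spanP.
exact: (UVB (u, v)).
Qed.

(* The join of a family of closed subspaces is its closed linear span, the
   meet its intersection; the meet of the empty family is the whole space. *)
Definition csjoin (S : set csubspace) : csubspace :=
  CSubspace (closed_span_subproof (\bigcup_(K in S) csset K)).

Lemma csmeet_subproof (S : set csubspace) :
  is_closed_subspace (\bigcap_(K in S) csset K).
Proof.
split.
- by move=> K _; case: (csubspaceP K).
- move=> a x y Sx Sy K SK; have [_ KP _] := csubspaceP K.
  by apply: KP; [exact: Sx|exact: Sy].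
- by apply: closed_bigI => K _; case: (csubspaceP K).
Qed.

Definition csmeet (S : set csubspace) : csubspace :=
  CSubspace (csmeet_subproof S).

Lemma csbot_subproof : is_closed_subspace [set 0 : X].
Proof.
split=> //; first by move=> a x y -> ->; rewrite scaler0 addr0.
exact/accessible_closed_set1/hausdorff_accessible/norm_hausdorff.
Qed.

Definition csbot : csubspace := CSubspace csbot_subproof.

Lemma cstop_subproof : is_closed_subspace [set: X].
Proof. by split=> //; exact: closedT. Qed.

Definition cstop : csubspace := CSubspace cstop_subproof.

Implicit Type L : set csubspace.

Definition subspace_lattice L : Prop :=
  [/\ L csbot, L cstop,
      forall S, S `<=` L -> L (csjoin S) &
      forall S, S `<=` L -> L (csmeet S)].

(* csminus L K is K_-. *)
Definition csminus L K : csubspace :=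
  csjoin [set M | L M /\ ~ (K `<=` M)].

Definition Jset L : set csubspace :=
  [set K | [/\ L K, K <> csbot & csminus L K <> cstop]].

Lemma Jset_sub L : Jset L `<=` L. Proof. by move=> K []. Qed.

Definition J_subspace_lattice L : Prop :=
  subspace_lattice L /\
  [/\ csjoin (Jset L) = cstop,
      csmeet [set csminus L K | K in Jset L] = csbot,
      forall K, Jset L K -> csjoin [set K; csminus L K] = cstop &
      forall K, Jset L K -> csmeet [set K; csminus L K] = csbot].

(* cssort K is the subspace K itself, with the norm inherited from X. *)
Definition cspred K : {pred X} := [pred x | `[< csset K x >]].

Definition cssort K : Type := {x : X | x \in cspred K}.
HB.instance Definition _ K := SubChoice.on (cssort K).

Lemma cspred_submod_closed K : GRing.subsemimod_closed (cspred K).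
Proof.
have [K0 KP _] := csubspaceP K.
split; last first.
  by move=> a x /asboolP Kx; apply/asboolP; rewrite -[_ *: _]addr0; apply: KP.
split; first exact/asboolP.
by move=> x y /asboolP Kx /asboolP Ky; apply/asboolP; rewrite -[x]scale1r; apply: KP.
Qed.

HB.instance Definition _ K := GRing.SubChoice_isSubLmodule.Build F X
  (cspred K) (cssort K) (cspred_submod_closed K).

Lemma cssort_normD K (x y : cssort K) :
  `|val (x + y)| <= `|val x| + `|val y|.
Proof. by rewrite raddfD ler_normD. Qed.

Lemma cssort_normZ K (a : F) (x : cssort K) :
  `|val (a *: x)| = `|a| * `|val x|.
Proof. by rewrite linearZ normrZ. Qed.

Lemma cssort_norm0_eq0 K (x : cssort K) : `|val x| = 0 -> x = 0.
Proof. by move=> /normr0_eq0 x0; apply: val_inj; rewrite x0 raddf0. Qed.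

HB.instance Definition _ K := @Lmodule_isNormed.Build F (cssort K)
  (fun x => `|val x|) (@cssort_normD K) (@cssort_normZ K) (@cssort_norm0_eq0 K).

End ClosedSubspace.

Arguments csubspace {F} X.

Section BoundedOperators.
Context {F : numFieldType} {V : normedModType F}.

Definition bounded_linear (f : V -> V) : Prop :=
  linear f /\ exists M : F, forall x, `|f x| <= M * `|x|.

Definition blpred : {pred V -> V} := [pred f | `[< bounded_linear f >]].

Record bop := Bop { bop_fun :> V -> V ; _ : bop_fun \in blpred }.

HB.instance Definition _ := [isSub for bop_fun].
HB.instance Definition _ := [Choice of bop by <:].

Lemma bopP (f : bop) : bounded_linear f.
Proof. by case: f => f fP; exact/asboolP. Qed.

Lemma blpred_submod_closed : GRing.subsemimod_closed blpred.
Proof.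
split; first split.
- apply/asboolP; split; first by move=> a x y; rewrite scaler0 addr0.
  by exists 0 => x; rewrite mul0r normr0.
- move=> f g /asboolP[fl [M fM]] /asboolP[gl [N gN]]; apply/asboolP; split.
    by move=> a x y /=; rewrite !fctE fl gl scalerDr addrACA.
  exists (M + N) => x; rewrite mulrDl (le_trans (ler_normD _ _))//.
  by rewrite lerD.
- move=> a f /asboolP[fl [M fM]]; apply/asboolP; split.
    by move=> b x y /=; rewrite !fctE fl scalerDr !scalerA mulrC.
  exists (`|a| * M) => x; rewrite fctE normrZ -mulrA.
  by rewrite ler_wpM2l.
Qed.

HB.instance Definition _ := GRing.SubChoice_isSubLmodule.Build F (V -> V)
  blpred bop blpred_submod_closed.

Lemma bop_one_subproof : (idfun : V -> V) \in blpred.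
Proof. by apply/asboolP; split => //; exists 1 => x; rewrite mul1r. Qed.

Lemma bop_mul_subproof (f g : bop) : (f \o g : V -> V) \in blpred.
Proof.
apply/asboolP; have [fl [M fM]] := bopP f; have [gl [N gN]] := bopP g.
split; first by move=> a x y /=; rewrite gl fl.
exists (`|M| * N) => x /=.
have nM (y : V) : `|f y| <= `|M| * `|y|.
  rewrite (le_trans (fM y))//; have := fM y.
  have [->|y0] := eqVneq y 0; first by rewrite normr0 !mulr0.
  move=> /(le_trans (normr_ge0 _)) M0; rewrite ger0_norm//.
  by rewrite -(@pmulr_lge0 _ `|y|) ?normr_gt0// mulrC.
by rewrite (le_trans (nM _))// -mulrA ler_wpM2l.
Qed.

Definition bop_one : bop := Bop bop_one_subproof.
Definition bop_mul (f g : bop) : bop := Bop (bop_mul_subproof f g).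

Lemma bop_mulA : associative bop_mul.
Proof. by move=> f g h; exact: val_inj. Qed.

Lemma bop_mul1f : left_id bop_one bop_mul.
Proof. by move=> f; exact: val_inj. Qed.

Lemma bop_mulf1 : right_id bop_one bop_mul.
Proof. by move=> f; exact: val_inj. Qed.

Lemma bop_mulDl : left_distributive bop_mul +%R.
Proof. by move=> f g h; exact: val_inj. Qed.

Lemma bop_mulDr : right_distributive bop_mul +%R.
Proof.
move=> f g h; apply: val_inj; apply/funext => x /=.
by have [fl _] := bopP f; have := fl 1 (g x) (h x); rewrite !scale1r.
Qed.

(* The product is composition. The ring is possibly zero (when V = 0), which
   is why it is not packaged as an lalgType. *)
HB.instance Definition _ := GRing.Zmodule_isPzRing.Build bop
  bop_mulA bop_mul1f bop_mulf1 bop_mulDl bop_mulDr.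

End BoundedOperators.

Arguments bop {F} V.

Section AlgLattice.
Context {F : numFieldType} {X : normedModType F}.
Implicit Types (L : set (csubspace X)) (K : csubspace X) (A : bop X).

Definition invariant K A : Prop := forall x, csset K x -> csset K (A x).

Definition algpred L : {pred bop X} :=
  [pred A | `[< forall K, L K -> invariant K A >]].

Definition alg L : Type := {A : bop X | A \in algpred L}.
HB.instance Definition _ L := SubChoice.on (alg L).

Lemma algP L (A : alg L) K : L K -> invariant K (val A).
Proof. by case: A => A AL LK; exact: (asboolP _ AL). Qed.

Lemma algpred_submod_closed L : GRing.subsemimod_closed (algpred L).
Proof.
split; first split.
- by apply/asboolP => K _ x _; have [] := csubspaceP K.
- move=> A B /asboolP AL /asboolP BL; apply/asboolP => K LK x Kx.
  have [_ KP _] := csubspaceP K.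
  have := KP 1 _ _ (AL K LK x Kx) (BL K LK x Kx).
  by rewrite scale1r.
- move=> a A /asboolP AL; apply/asboolP => K LK x Kx.
  have [K0 KP _] := csubspaceP K.
  by have := KP a _ _ (AL K LK x Kx) K0; rewrite addr0.
Qed.

HB.instance Definition _ L := GRing.SubChoice_isSubLmodule.Build F (bop X)
  (algpred L) (alg L) (algpred_submod_closed L).

Lemma algpred_subring_closed L : subring_closed (algpred L).
Proof.
split.
- by apply/asboolP => K _ x.
- move=> A B /asboolP AL /asboolP BL; apply/asboolP => K LK x Kx.
  have [_ KP _] := csubspaceP K.
  have := KP (-1) _ _ (BL K LK x Kx) (AL K LK x Kx).
  by rewrite scaleN1r addrC.
- move=> A B /asboolP AL /asboolP BL; apply/asboolP => K LK x Kx.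
  exact/AL/BL.
Qed.

HB.instance Definition _ L := GRing.SubZmodule_isSubPzRing.Build (bop X)
  (algpred L) (alg L) (algpred_subring_closed L).

Lemma csval_subproof K (x : cssort K) : csset K (val x).
Proof. by case: x => x Kx; exact/asboolP. Qed.

Definition restr_fun A K (AK : invariant K A) (x : cssort K) : cssort K :=
  exist _ (A (val x)) (introT (asboolP _) (AK _ (csval_subproof x))).

Lemma restr_subproof A K (AK : invariant K A) : restr_fun AK \in blpred.
Proof.
have [Al [M AM]] := bopP A; apply/asboolP; split.
  move=> a x y; apply: val_inj; rewrite [RHS]linearP /= -Al.
  by congr (A _); exact: linearP.
by exists M => x; exact: AM.
Qed.

Definition restr A K (AK : invariant K A) : bop (cssort K) :=
  Bop (restr_subproof AK).

Definition alg_restr L (A : alg L) K (LK : L K) : bop (cssort K) :=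
  restr (algP A LK).

End AlgLattice.

Definition lie {A : pzRingType} (a b : A) : A := a * b - b * a.

Section Delta.
Context {A : pzRingType}.
Implicit Types (d : nat -> A -> A) (a x : A).

(* inner_seq a k is the sequence [a, k], for k >= 1. *)
Definition inner_seq a (k n : nat) x : A :=
  if n == 0%N then x
  else if (k %| n)%N then
    let r := (n %/ k)%N in a ^+ r * x - a ^+ r.-1 * x * a
  else 0.

Definition star d d' (n : nat) x : A := \sum_(i < n.+1) d i (d' (n - i)%N x).

(* The neutral sequence (id, 0, 0, ...): it only serves as the value of the
   empty product. *)
Definition star_unit (n : nat) x : A := if n == 0%N then x else 0.

(* The sequence T is indexed from 1: the value T 0 is not used. *)
Definition Delta (T : nat -> A) (n : nat) : A -> A :=
  (\big[star/star_unit]_(1 <= k < n.+1) inner_seq (T k) k) n.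

End Delta.

(* Main.v *)
Require Import Defs.
From HB Require Import structures.
From mathcomp Require Import all_boot all_order all_algebra.
From mathcomp Require Import all_classical all_reals all_analysis.
From mathcomp Require Import complex.
From mathcomp Require Import ring lra.

(** Why the theorem holds. Restrict everything to a member K of J(L), and let
A act on K by its restriction.

Each sequence [a, k] is a higher derivation: its generating function is
conjugation by 1 - a t^k. The product of higher derivations is a higher
derivation, so the Delta_n satisfy the Leibniz rule, hence
Delta_n [A, B] = sum of the [Delta_i A, Delta_j B]. If L_n is Delta_n plus a
scalar on every K, the scalars drop out of the commutators, and the required
identity holds on every K; as the members of J(L) span a dense subspace, it
holds on X. This is the implication from right to left, and also the reason
why the functionals h_n of the converse vanish on the commutators [A, B] with
AB = 0.

For the converse, T_n is found by induction on n. The generator T_n enters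
Delta_n only through the additive term [T_n, A]. So let phi be L_n restricted
to K, minus Delta_n formed with T_n = 0. By the Leibniz rule and the
induction hypothesis, phi is a linear map from Alg L to B(K) with
phi [A, B] = [phi A, B] + [A, phi B] whenever AB = 0, and it remains to write
phi as [S, -] plus a scalar (lie_derivable_inner).

Alg L contains the operators x (x) f : v |-> f(v) x for x in K and f a bounded
functional vanishing on K_-. As K and K_- meet in 0, the Hahn-Banach theorem
shows that these f separate the points of K. The defect
Psi(A, B) = phi [A, B] - [phi A, B] - [A, phi B] is bilinear, antisymmetric
and vanishes when AB = 0. Splitting along an idempotent E gives
Psi(AE, B) = Psi(A, EB), and every x (x) f is a combination of idempotents
of this form. Comparing Psi(A, N), Psi(AN, 1) and Psi(NA, 1) for N = x (x) f
shows that phi(1) commutes with every [A, N], so phi(1) is a scalar on K, and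
then Psi(A, N) = 0: phi behaves as a Lie derivation as soon as one of
the two arguments has rank one.

Fix f0 and x0 with f0(x0) = 1. The only possible generator, normalised by
f0(T x0) = 0, is T y = phi(y (x) f0) x0 - al f0(y) x0 with
al = f0(phi(x0 (x) f0) x0). Evaluating the Lie identity on rank one operators
gives phi(x (x) f) = [T, x (x) f] + al f(x), and then evaluating it on A and
x (x) f0 at the vector x0 gives phi(A) = [T, A] + scalar. No continuity of phi
is assumed, so T is not bounded for free: the formula for phi(x0 (x) f) shows
that f o T is bounded for every f as above, and since these f separate points
the closed graph theorem applies.

The Hahn-Banach and closed graph theorems are proved over the reals, and
reach both scalar fields by restriction of scalars. *)

Set Implicit Arguments.
Unset Strict Implicit.
Unset Printing Implicit Defensive.

Import Order.TTheory GRing.Theory Num.Theory.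
Import numFieldNormedType.Exports.

Local Open Scope classical_set_scope.
Local Open Scope ring_scope.

(** * Higher derivations and the maps Delta *)

Section LieRing.
Variable A : pzRingType.
Implicit Types a b c : A.

Lemma lieC a b : lie a b = - lie b a.
Proof. by rewrite /lie opprB. Qed.

Lemma lieBl a b c : lie (a - b) c = lie a c - lie b c.
Proof. by rewrite /lie mulrBl mulrBr !opprD !opprK addrACA. Qed.

Lemma lieBr a b c : lie a (b - c) = lie a b - lie a c.
Proof. by rewrite lieC lieBl opprB [in RHS]lieC [lie a c]lieC opprK addrC. Qed.

Lemma lie1 a : lie a 1 = 0.
Proof. by rewrite /lie mulr1 mul1r subrr. Qed.

End LieRing.

Section Convolution.
Variable V : nmodType.

Lemma conv_assoc (G : nat -> nat -> nat -> V) n :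
  \sum_(i < n.+1) \sum_(j < (n - i).+1) G i j (n - i - j)%N =
  \sum_(m < n.+1) \sum_(i < m.+1) G i (m - i)%N (n - m)%N.
Proof.
elim: n G => [|n IHn] G; first by rewrite !big_ord1.
rewrite big_ord_recl subn0.
under [X in _ + X]eq_bigr do rewrite lift0 subSS.
rewrite (IHn (fun i => G i.+1)).
under [RHS]eq_bigr do rewrite big_ord_recl subn0 /=.
rewrite big_split /=; congr (_ + _).
rewrite [RHS]big_ord_recl big_ord0 add0r; apply: eq_bigr => m _.
rewrite lift0 subSS; apply: eq_bigr => i _.
by rewrite /bump leq0n add1n subSS.
Qed.

Lemma conv_rev (F : nat -> nat -> V) n :
  \sum_(i < n.+1) F i (n - i)%N = \sum_(i < n.+1) F (n - i)%N i.
Proof.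
rewrite (reindex_inj rev_ord_inj) /=; apply: eq_bigr => i _.
by rewrite subSS subKn // -ltnS.
Qed.

(** Both iterated sums run over the triples (i, j, k) with i + j + k = n. *)
Lemma conv_swap (G : nat -> nat -> nat -> V) n :
  \sum_(i < n.+1) \sum_(j < (n - i).+1) G i j (n - i - j)%N =
  \sum_(j < n.+1) \sum_(i < (n - j).+1) G i j (n - j - i)%N.
Proof.
rewrite conv_assoc (conv_assoc (fun i j => G j i)); apply: eq_bigr => m _.
exact: (conv_rev (fun i j => G i j (n - m)%N)).
Qed.

End Convolution.

Section HigherDerivations.
Variable A : pzRingType.
Implicit Types (d : nat -> A -> A) (T : nat -> A) (a x y : A).

Definition higher_derivation d :=
  [/\ d 0%N =1 id, forall n x y, d n (x - y) = d n x - d n y &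
      forall n x y, d n (x * y) = \sum_(i < n.+1) d i x * d (n - i)%N y].

Lemma hderivS d n I (r : seq I) (P : pred I) (F : I -> A) : higher_derivation d ->
  d n (\sum_(i <- r | P i) F i) = \sum_(i <- r | P i) d n (F i).
Proof.
case=> _ dB _; have d0 : d n 0 = 0 by rewrite -[X in d n X](subrr 0) dB subrr.
apply: (big_morph (d n) _ d0) => x y.
by rewrite -{1}[y]opprK dB -[- y]sub0r dB d0 sub0r opprK.
Qed.

Lemma hderiv_lie d n x y : higher_derivation d ->
  d n (lie x y) = \sum_(i < n.+1) lie (d i x) (d (n - i)%N y).
Proof.
case=> _ dB dM; rewrite /lie dB !dM sumrB; congr (_ - _).
exact: (conv_rev (fun i j => d i y * d j x)).
Qed.

(** Composition of the algebra morphisms A -> A[[t]] given by two higher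
derivations: both sides of the Leibniz rule are the sum over l + p + j + q = n
of d_l (d'_j x) * d_p (d'_q y). *)
Lemma star_higher_derivation d d' :
  higher_derivation d -> higher_derivation d' -> higher_derivation (star d d').
Proof.
move=> hd hd'; have [d0 dB dM] := hd; have [d'0 d'B d'M] := hd'.
split=> [x|n x y|n x y].
- by rewrite /star big_ord1 d0 d'0.
- by rewrite /star -sumrB; apply: eq_bigr => i _; rewrite d'B dB.
pose H l p j q := d l (d' j x) * d p (d' q y).
transitivity (\sum_(i < n.+1) \sum_(l < i.+1)
    \sum_(j < (n - i).+1) H l (i - l)%N j (n - i - j)%N).
  apply: eq_bigr => i _; rewrite d'M hderivS // exchange_big /=.
  by apply: eq_bigr => j _; rewrite dM.
pose H1 l p q := \sum_(j < q.+1) H l p j (q - j)%N.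
rewrite -(conv_assoc H1) /H1.
under eq_bigr => l _ do rewrite (conv_swap (fun p j => H l p j)).
pose H2 l j q := \sum_(p < q.+1) H l p j (q - p)%N.
rewrite (conv_assoc H2) /H2; apply: eq_bigr => m _.
rewrite /star big_distrl /=; apply: eq_bigr => l _.
by rewrite big_distrr.
Qed.

Lemma star_unit_higher_derivation : higher_derivation (@star_unit A).
Proof.
split=> // [[|n] x y|[|n] x y]; rewrite /star_unit ?subrr ?big_ord1 //=.
by rewrite big1 // => -[[|i] ?] _; rewrite ?mulr0 ?mul0r.
Qed.

(** The recurrence behind the Leibniz rule: away from degree 0, shifting the
degree by k is left multiplication by a. *)
Lemma inner_seq_shift a k n x : (0 < k)%N ->
  inner_seq a k (n + k) x =
  a * inner_seq a k n x - (if n == 0%N then x * a else 0).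
Proof.
move=> k0; rewrite /inner_seq addn_eq0 (gtn_eqF k0) andbF dvdn_addl //.
have [->|n0] := eqVneq n 0%N.
  by rewrite dvdn0 add0n divnn k0 /= expr1 expr0 mul1r.
case: ifP => kn; last by rewrite mulr0 subr0.
rewrite divnDr // divnn k0 addn1 subr0 mulrBr !mulrA -exprS.
by rewrite -exprS prednK // divn_gt0 // dvdn_leq // lt0n.
Qed.

Lemma inner_seq_small a k n x : (0 < n < k)%N -> inner_seq a k n x = 0.
Proof.
case/andP=> n0 nk; rewrite /inner_seq (gtn_eqF n0).
by rewrite gtnNdvd.
Qed.

(** By induction on the degree, in steps of k. In degree p + k the terms with
0 < i < k vanish, the term i = 0 is x * s_{p+k}(y), and the recurrence turns the
others into a * s_p(x * y) - x * a * s_p(y). *)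
Lemma inner_seq_higher_derivation a k : (0 < k)%N ->
  higher_derivation (inner_seq a k).
Proof.
move=> k0; split=> // [n x y|n].
  rewrite /inner_seq; case: eqP => // _; case: ifP => _; last by rewrite subrr.
  by rewrite /= !mulrBr !mulrBl !opprD !opprK addrACA.
have [m] := ubnP n; elim: m n => // m IHm n nm x y.
have [nk|kn] := ltnP n k.
  have [->|n0] := posnP n; first by rewrite big_ord1.
  rewrite inner_seq_small ?n0 // big1 // => -[[|i] /= ilt] _.
    by rewrite subn0 (@inner_seq_small _ _ n) ?n0 // mulr0.
  by rewrite (@inner_seq_small _ _ i.+1) ?mul0r // (leq_ltn_trans _ nk).
have pm : (n - k < m)%N.
  by apply: leq_trans (nm : (n <= m)%N); rewrite ltn_subrL k0 (leq_trans k0 kn).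
rewrite -(subnK kn); move: (n - k)%N pm => p pm.
rewrite -(big_mkord xpredT (fun i => inner_seq a k i x * inner_seq a k (p + k - i) y)).
rewrite (@big_cat_nat _ _ _ k) //=; last by rewrite -addSn leq_addl.
rewrite -(prednK k0) big_nat_recl // prednK // big1_seq ?addr0; last first.
  move=> i /=; rewrite mem_index_iota => /andP[_ ik].
  by rewrite inner_seq_small ?mul0r //= -ltn_predRL.
rewrite subn0 -[X in \big[_/_]_(X <= _ < _) _](add0n k) -addSn big_addn addnK big_mkord.
under eq_bigr => i _ do rewrite inner_seq_shift // subnDr mulrBl -mulrA.
rewrite sumrB -mulr_sumr -IHm // big_ord_recl /= subn0 [X in _ - (_ + X)]big1; last first.
  by move=> i _; rewrite mul0r.
rewrite addr0 !inner_seq_shift // mulrBr.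
change (inner_seq a k 0 x) with x.
case: eqP => [->|_] /=; last by rewrite mulr0 !subr0 !mulrA addrC subrK.
by rewrite /inner_seq /= !mulrA [RHS]addrC subrKA.
Qed.

(** Unlike Delta, whose number of factors grows with the degree, a product over
a fixed list of indices is a single sequence, to which the Leibniz rule applies
in all degrees at once. *)
Definition prodseq T (r : seq nat) : nat -> A -> A :=
  \big[star/star_unit]_(k <- r) inner_seq (T k) k.

Lemma prodseq_higher_derivation T (r : seq nat) :
  all (fun k => 0 < k)%N r -> higher_derivation (prodseq T r).
Proof.
rewrite /prodseq; elim: r => [|k r IHr] /=.
  by rewrite big_nil => _; apply: star_unit_higher_derivation.
case/andP=> k0 r0; rewrite big_cons; apply: star_higher_derivation (IHr r0).
exact: inner_seq_higher_derivation.
Qed.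

(** Below degree n the sequence [T n, n] agrees with the neutral sequence, so a
factor [T n, n] on the right only shows in degree n, through its own term of
that degree. *)
Lemma prodseq_rcons T r n x : (0 < n)%N -> all (fun k => 0 < k)%N r ->
  (forall i, (i < n)%N -> prodseq T (rcons r n) i x = prodseq T r i x) /\
  prodseq T (rcons r n) n x = prodseq T r n x + lie (T n) x.
Proof.
rewrite /prodseq => n0; elim: r x => [|k r IHr] x /=.
  rewrite !big_cons big_nil => _; split=> [i ilt|].
    rewrite /star big_ord_recr /= subnn big1 ?add0r => [|[j /= ji] _].
      case: i ilt => [|i] ilt //.
      by rewrite inner_seq_small //= ilt.
    rewrite /star_unit gtn_eqF ?subn_gt0 //.
    have [-> //|j0] := posnP j.
    by rewrite inner_seq_small // j0 (ltn_trans ji).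
  rewrite /star big_ord_recr /= subnn big1 ?add0r => [|[j /= ji] _].
    by rewrite /star_unit /inner_seq gtn_eqF // dvdnn divnn n0 /= expr0 mul1r add0r.
  rewrite /star_unit gtn_eqF ?subn_gt0 //.
  have [-> //|j0] := posnP j.
  by rewrite inner_seq_small // j0.
case/andP=> k0 r0; rewrite !big_cons; have [IH1 IH2] := IHr x r0; split.
  move=> i ilt; rewrite /star; apply: eq_bigr => j _; rewrite IH1 //.
  by apply: leq_ltn_trans ilt; rewrite leq_subr.
rewrite /star !big_ord_recl /= !subn0 IH2 -addrA [X in _ + X]addrC addrA.
congr (_ + _ + _); apply: eq_bigr => j _; rewrite IH1 //.
by rewrite /bump leq0n add1n ltn_subrL.
Qed.

Lemma DeltaE T n : Delta T n = prodseq T (iota 1 n) n.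
Proof. by rewrite /Delta /prodseq /index_iota subSS subn0. Qed.

Lemma iota_pos n : all (fun k => 0 < k)%N (iota 1 n).
Proof. by apply/allP => k; rewrite mem_iota => /andP[]. Qed.

Lemma prodseq_Delta T n i x : (i <= n)%N -> prodseq T (iota 1 n) i x = Delta T i x.
Proof.
elim: n => [|n IHn]; first by rewrite leqn0 => /eqP ->; rewrite DeltaE.
rewrite leq_eqVlt => /orP[/eqP ->|]; first by rewrite DeltaE.
move=> iln; rewrite -[n.+1]addn1 iotaD add1n cats1.
by rewrite (proj1 (prodseq_rcons _ _ _ _)) ?IHn // iota_pos.
Qed.

Lemma Delta0 T x : Delta T 0 x = x.
Proof. by rewrite DeltaE /prodseq big_nil. Qed.

Lemma DeltaB T n x y : Delta T n (x - y) = Delta T n x - Delta T n y.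
Proof. by rewrite DeltaE; have [_ -> _] := prodseq_higher_derivation T (iota_pos n). Qed.

Lemma DeltaD T n x y : Delta T n (x + y) = Delta T n x + Delta T n y.
Proof.
have D0 : Delta T n 0 = 0 by rewrite -[X in Delta _ _ X](subrr 0) DeltaB subrr.
by rewrite -{1}[y]opprK DeltaB -[- y]sub0r DeltaB D0 sub0r opprK.
Qed.

Lemma Delta_lie T n x y :
  Delta T n (lie x y) = \sum_(i < n.+1) lie (Delta T i x) (Delta T (n - i) y).
Proof.
rewrite DeltaE (hderiv_lie _ _ _ (prodseq_higher_derivation T (iota_pos n))).
by apply: eq_bigr => i _; rewrite !prodseq_Delta ?leq_subr // -ltnS.
Qed.

Lemma eq_Delta T T' n x : (forall k, (0 < k <= n)%N -> T k = T' k) ->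
  Delta T n x = Delta T' n x.
Proof.
move=> eT; rewrite !DeltaE /prodseq.
congr (_ n x); apply: eq_big_seq => k; rewrite mem_iota add1n ltnS => kn.
by rewrite eT.
Qed.

(** The last generator enters Delta_n additively; this is what makes it
possible to choose the generators one after the other. *)
Lemma Delta_top T n x : (0 < n)%N ->
  Delta T n x = Delta (fun k => if k == n then 0 else T k) n x + lie (T n) x.
Proof.
case: n => // n _; rewrite !DeltaE -[n.+1]addn1 iotaD add1n cats1 addn1.
rewrite !(proj2 (prodseq_rcons _ _ _ _)) ?iota_pos // eqxx.
rewrite [lie 0 x]/lie mul0r mulr0 subrr addr0; congr (_ + _).
congr (_ _ x); apply: eq_big_seq => k; rewrite mem_iota add1n => /andP[_ kn].
by rewrite ltn_eqF.
Qed.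

(** Used for s the multiplication by a scalar, as the operators on a possibly
zero space carry no algebra structure. *)
Lemma Delta_comm T n (s : A -> A) x : (forall a b, s (a - b) = s a - s b) ->
  (forall a b, s (a * b) = a * s b) -> (forall a b, s (a * b) = s a * b) ->
  Delta T n (s x) = s (Delta T n x).
Proof.
move=> sB sr sl; rewrite DeltaE /prodseq.
have s0 : s 0 = 0 by rewrite -[X in s X](subrr 0) sB subrr.
have sD a b : s (a + b) = s a + s b.
  by rewrite -{1}[b]opprK sB -[- b]sub0r sB s0 sub0r opprK.
move: (iota 1 n) => r; elim: r n x => [|k r IHr] n x.
  by rewrite big_nil /star_unit; case: eqP; rewrite ?s0.
rewrite big_cons /star (big_morph s sD s0); apply: eq_bigr => i _; rewrite IHr.
rewrite /inner_seq; case: eqP => // _; case: ifP => _; rewrite ?s0 //=.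
by rewrite sB sr sl sr.
Qed.

End HigherDerivations.

(** * The Hahn-Banach and closed graph theorems over the reals *)

Section HahnBanach.
Variables (R : realType) (V : lmodType R).
Implicit Types (p q : V -> R) (a x y : V).

(** Positive homogeneity is only asked as an inequality for t > 0; the equality
for t >= 0 follows by applying it to 1 / t. *)
Definition sublinear p :=
  (forall x y, p (x + y) <= p x + p y) /\
  (forall t x, 0 < t -> p (t *: x) <= t * p x).

Lemma sublinearZ p t x : sublinear p -> 0 <= t -> p (t *: x) = t * p x.
Proof.
case=> pD pZ; rewrite le_eqVlt => /orP[/eqP <-|t0].
  rewrite scale0r mul0r; apply/eqP; rewrite eq_le; apply/andP; split.
    have := pZ 2^-1 0 ltac:(by rewrite invr_gt0); rewrite scaler0 => h; lra.
  by have := pD 0 0; rewrite addr0 => h; lra.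
apply/eqP; rewrite eq_le pZ //=.
have := pZ t^-1 (t *: x); rewrite invr_gt0 t0 scalerK ?gt_eqF // => /(_ isT).
by rewrite mulrC ler_pdivlMr // mulrC.
Qed.

Lemma sublinear0 p : sublinear p -> p 0 = 0.
Proof. by move=> ps; rewrite -[0](scale0r (0 : V)) sublinearZ // mul0r. Qed.

Lemma sublinear_oppr p x : sublinear p -> - p (- x) <= p x.
Proof.
move=> ps; have := proj1 ps x (- x); rewrite subrr sublinear0 // => h; lra.
Qed.

(** Among the sublinear functionals below q, the one obtained by making q
additive in the direction a as far as possible. *)
Definition slide q a x := inf [set q (x + t *: a) - t * q a | t in [set t | 0 <= t]].

Lemma slide_le q a x t : sublinear q -> 0 <= t ->
  slide q a x <= q (x + t *: a) - t * q a.
Proof.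
move=> qs t0; apply: ge_inf; last by exists t.
exists (- q (- x)) => _ [s /= s0 <-].
have := proj1 qs (x + s *: a) (- x); rewrite addrAC subrr add0r sublinearZ //.
by move=> h; lra.
Qed.

Lemma slide_ge q a x c : (forall t, 0 <= t -> c <= q (x + t *: a) - t * q a) ->
  c <= slide q a x.
Proof.
move=> h; apply: lb_le_inf; last by move=> _ [t /= t0 <-]; apply: h.
by exists (q (x + 0 *: a) - 0 * q a), 0; rewrite ?lexx /=.
Qed.

Lemma slide_sublinear q a : sublinear q -> sublinear (slide q a).
Proof.
move=> qs; split=> [x y|s x s0].
  rewrite -lerBlDr; apply: slide_ge => t t0; rewrite lerBlDr [leRHS]addrC -lerBlDr.
  apply: slide_ge => r r0; rewrite lerBlDr.
  have := slide_le a (x + y) qs (addr_ge0 t0 r0); rewrite scalerDl addrACA.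
  have := proj1 qs (x + t *: a) (y + r *: a); rewrite mulrDl.
  by move=> h1 h2; lra.
rewrite -ler_pdivrMl //; apply: slide_ge => t t0; rewrite ler_pdivrMl //.
have := slide_le a (s *: x) qs (mulr_ge0 (ltW s0) t0).
rewrite -scalerA -scalerDr (sublinearZ _ qs (ltW s0)) => h.
by apply: (le_trans h); rewrite mulrBr mulrA.
Qed.

Lemma slide_decr q a x : sublinear q -> slide q a x <= q x.
Proof. by move=> qs; have := slide_le a x qs (lexx 0); rewrite scale0r mul0r addr0 subr0. Qed.

(** Zorn: a chain of sublinear functionals below p has its pointwise infimum
as a lower bound, which is finite because q x >= - q (- x) >= - p (- x). *)
Lemma minimal_sublinear p : sublinear p -> exists q, [/\ sublinear q,
  forall x, q x <= p x &
  forall q', sublinear q' -> (forall x, q' x <= q x) -> q' = q].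
Proof.
move=> ps; pose T := {q | sublinear q /\ forall x, q x <= p x}.
pose r (s t : T) := `[< forall x, sval t x <= sval s x >].
have [|||A totA|[q [qs qp]] qmin] := @Zorn T r.
- by move=> t; apply/asboolP.
- move=> s t u /asboolP st /asboolP tu; apply/asboolP => x.
  exact: le_trans (tu x) (st x).
- move=> [s hs] [t ht] /asboolP st /asboolP ts; apply: eq_exist => /=.
  by apply/funext => x; apply/eqP; rewrite eq_le st ts.
- have [->|/set0P[t0 At0]] := eqVneq A set0.
    by exists (exist _ p (conj ps (fun x => lexx _))).
  pose f x := inf [set sval t x | t in A].
  have fle x t : A t -> f x <= sval t x.
    move=> At; apply: ge_inf; last by exists t.
    exists (- p (- x)) => _ [[s [ss sp]] As <-] /=.
    by apply: le_trans (sublinear_oppr x ss); rewrite lerN2.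
  have fge x c : (forall t, A t -> c <= sval t x) -> c <= f x.
    by move=> h; apply: lb_le_inf => [|_ [t At <-]]; [exists (sval t0 x), t0|exact: h].
  have fs : sublinear f.
    split=> [x y|s x s0].
      rewrite -lerBlDr; apply: (fge) => t At; rewrite lerBlDr [leRHS]addrC -lerBlDr.
      apply: (fge) => u Au; rewrite lerBlDr.
      case: (totA _ _ At Au) => /asboolP le.
        apply: (le_trans (fle (x + y) _ Au)).
        apply: (le_trans (proj1 (proj1 (svalP u)) x y)).
        by rewrite addrC lerD2l.
      apply: (le_trans (fle (x + y) _ At)).
      apply: (le_trans (proj1 (proj1 (svalP t)) x y)).
      by rewrite addrC lerD2r.
    rewrite -ler_pdivrMl //; apply: (fge) => t At; rewrite ler_pdivrMl //.
    exact: le_trans (fle _ _ At) (proj2 (proj1 (svalP t)) _ _ s0).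
  have fp x : f x <= p x by apply: le_trans (fle x _ At0) (proj2 (svalP t0) x).
  by exists (exist _ f (conj fs fp)) => t At; apply/asboolP => x /=; exact: fle.
exists q; split=> // q' q's q'q.
have q'p x : q' x <= p x by exact: le_trans (q'q x) (qp x).
exact: (congr1 sval (qmin (exist _ q' (conj q's q'p)) (asboolT q'q))).
Qed.

(** A minimal sublinear functional is unchanged by slide, which makes it
additive, hence linear. Starting from slide p v instead of p forces the value
at v, since slide p v (- v) <= - p v. *)
Theorem hahn_banach p (v : V) : sublinear p ->
  exists g : {scalar V}, (forall x, g x <= p x) /\ g v = p v.
Proof.
move=> ps; have [q [qs qp qmin]] := minimal_sublinear (slide_sublinear v ps).
have qslide a : slide q a = q.
  by apply: qmin; [exact: slide_sublinear|move=> x; exact: slide_decr].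
have qD x y : q (x + y) = q x + q y.
  apply/eqP; rewrite eq_le (proj1 qs) -lerBrDr -{1}(qslide y).
  by have := slide_le y x qs (@ler01 R); rewrite scale1r mul1r.
have qN x : q (- x) = - q x.
  by apply/eqP; rewrite -addr_eq0 -qD addNr sublinear0.
have qlin : linear q.
  move=> t x y; rewrite qD; congr (_ + _).
  have [t0|/ltW t0] := leP 0 t; first by rewrite sublinearZ.
  rewrite -[t]opprK scaleNr qN (sublinearZ _ qs) ?oppr_ge0 //.
  by rewrite mulNr !opprK.
pose g : {scalar V} := HB.pack q (GRing.isLinear.Build _ _ _ _ _ qlin).
have gp x : q x <= p x by apply: le_trans (qp x) (slide_decr v x ps).
exists g; split=> //=; apply/eqP; rewrite eq_le gp /=.
have := le_trans (qp (- v)) (slide_le v (- v) ps (@ler01 R)).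
by rewrite scale1r mul1r addNr sublinear0 // qN sub0r lerN2.
Qed.

End HahnBanach.

Section ClosedGraph.
Variables (R : realType) (U W : completeNormedModType R) (T : {linear U -> W}).

(** By the Baire theorem the closure of some {x | |T x| <= n} contains a ball;
recentring by differences and rescaling, every x is approximated arbitrarily
well by points y with |T y| <= C |x|. *)
Lemma graph_almost_open : exists C : R, 0 < C /\
  forall x d, 0 < d -> exists y, `|x - y| <= d /\ `|T y| <= C * `|x|.
Proof.
pose E n := [set x | `|T x| <= n%:R].
have [n ndense] : exists n, ~ dense (~` closure (E n)).
  apply/not_existsP => hn.
  have : forall n, open (~` closure (E n)) /\ dense (~` closure (E n)).
    move=> n; split; first exact/closed_openC/closed_closure.
    by apply: contrapT; exact: hn.
  move=> /Baire /(_ setT) [||x [_ /(_ (Num.truncn `|T x|).+1 Logic.I)]].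
  - by exists 0.
  - exact: openT.
  by apply; apply: subset_closure; rewrite /E /=; apply: ltW; exact: truncnS_gt.
have [a [r r0 arE]] : exists a, exists2 r, 0 < r & ball a r `<=` closure (E n).
  have [D [[a aD] DE]] := denseNE ndense.
  have /nbhs_ballP[r /= r0 rD] := open_nbhs_nbhs aD.
  exists a, r => // x /rD Dx; apply: contrapT => nx.
  by have : (D `&` ~` closure (E n)) x by []; rewrite DE.
have small x d : `|x| < r -> 0 < d ->
    exists y, `|x - y| <= d /\ `|T y| <= 2 * n%:R.
  move=> xr d0; have d20 : 0 < d / 2 by rewrite divr_gt0.
  have [u [Eu]] : E n `&` ball (a + x) (d / 2) !=set0.
    apply: arE; last exact: nbhsx_ballx.
    by rewrite -ball_normE /ball_ /= opprD addrA subrr sub0r normrN.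
  have [v [Ev]] : E n `&` ball a (d / 2) !=set0.
    by apply: arE; [exact: ballxx|exact: nbhsx_ballx].
  rewrite -!ball_normE /ball_ /= => av axu.
  exists (u - v); split.
    have -> : x - (u - v) = (a + x - u) - (a - v).
      by rewrite !opprB [RHS]addrAC [a + x]addrC [x + a + _]addrACA subrr addr0 addrA.
    by apply: (le_trans (ler_normB _ _)); rewrite [leRHS]splitr lerD // ltW.
  rewrite raddfB (le_trans (ler_normB _ _)) //.
  by rewrite mulrDl mul1r lerD.
(* 4 n / r is what the rescaling to norm r / 2 yields; + 1 makes it positive
   even if n = 0 *)
exists (4 * n%:R / r + 1); split.
  by rewrite ltr_wpDl // divr_ge0 ?mulr_ge0 ?ler0n ?ltW.
move=> x d d0; have [->|x0] := eqVneq x 0.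
  by exists 0; rewrite subrr raddf0 !normr0 mulr0 ltW.
have nx0 : 0 < `|x| by rewrite normr_gt0.
pose s := r / (2 * `|x|).
have s0 : 0 < s by rewrite divr_gt0 // mulr_gt0.
have [|y [xy Ty]] := small (s *: x) (s * d) _ (mulr_gt0 s0 d0).
  rewrite normrZ gtr0_norm // /s invfM mulrA mulfVK ?gt_eqF //; lra.
exists (s^-1 *: y); split.
  rewrite -(ler_pM2l s0) -{1}(gtr0_norm s0) -normrZ scalerBr scalerA.
  by rewrite divff ?gt_eqF // scale1r.
rewrite linearZ normrZ gtr0_norm ?invr_gt0 // mulrC ler_pdivrMr //.
apply: (le_trans Ty).
have -> : (4 * n%:R / r + 1) * `|x| * s = 2 * n%:R + r / 2.
  by rewrite /s; field; rewrite ?gt_eqF.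
by rewrite lerDl divr_ge0 // ltW.
Qed.

(** Successive approximation: x is the sum of vectors y_k with
|T y_k| <= C |x| / 2^k, so the remainders e_k tend to 0 while T e_k converges;
closedness of the graph makes this limit 0, and T x is the sum of the T y_k. *)
Theorem closed_graph_bounded :
  (forall (u : U ^nat) w, u @ \oo --> 0 -> (T \o u) @ \oo --> w -> w = 0) ->
  exists M : R, forall x, `|T x| <= M * `|x|.
Proof.
move=> clT; have [C [C0 hC]] := graph_almost_open.
have /choice[Y hY] : forall p : U * R, exists y, 0 < p.2 ->
    `|p.1 - y| <= p.2 /\ `|T y| <= C * `|p.1|.
  move=> [x d] /=; have [d0|_] := ltP 0 d; last by exists 0.
  by have [y] := hC x d d0; exists y.
exists (2 * C) => x; have [->|x0] := eqVneq x 0.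
  by rewrite raddf0 !normr0 mulr0.
have nx0 : 0 < `|x| by rewrite normr_gt0.
pose d k : R := `|x| * 2^-1 ^+ k.
have d0 k : 0 < d k by rewrite mulr_gt0 // exprn_gt0.
pose fix e k := if k is k'.+1 then e k' - Y (e k', d k) else x.
have ed k : `|e k| <= d k.
  case: k => [|k] /=; first by rewrite /d mulr1.
  exact: (hY (e k, d k.+1) (d0 _)).1.
have Te k : `|T (e k.+1) - T (e k)| <= C * d k.
  rewrite -raddfB /= addrAC subrr sub0r raddfN normrN.
  apply: (le_trans (hY (e k, d k.+1) (d0 _)).2) => /=.
  by rewrite ler_pM2l.
pose v k := T (e k.+1) - T (e k).
have sv n : series v n = T (e n) - T x.
  by rewrite /series /= telescope_sumr.
have half : `|2^-1 : R| < 1 by rewrite ger0_norm; lra.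
have cv : cvgn (series v).
  apply: normed_cvg; apply: (series_le_cvg (v_ := geometric (C * `|x|) 2^-1)).
  - by move=> n; rewrite /= normr_ge0.
  - by move=> n; rewrite /= mulr_ge0 ?exprn_ge0 // mulr_ge0 // ltW.
  - by move=> n; rewrite /= -mulrA; exact: Te.
  - exact: is_cvg_geometric_series.
have cTe : (T \o e) @ \oo --> limn (series v) + T x.
  have -> : T \o e = (fun n => series v n + T x).
    by apply/funext => n; rewrite sv subrK.
  by apply: cvgD => //; exact: cvg_cst.
have ce : e @ \oo --> 0.
  apply/norm_cvg0P; apply: (@squeeze_cvgr _ _ _ _ (cst 0) d).
  - by apply: nearW => n; rewrite normr_ge0 ed.
  - exact: cvg_cst.
  - exact: (cvg_geometric _ half).
have l0 := clT e _ ce cTe.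
have Sv n : `|series v n| <= 2 * C * `|x|.
  apply: (le_trans (ler_norm_sum _ _ _)).
  have -> : 2 * C * `|x| = (C * `|x|) * (1 - 2^-1)^-1 by field.
  apply: le_trans (geometric_le_lim n _ _ half) => //; last first.
    by rewrite mulr_ge0 // ltW.
  by apply: ler_sum => i _; rewrite /= -mulrA; exact: Te.
apply/ler_addgt0Pl => eps eps0.
rewrite l0 in cTe.
have /cvgrPdist_lt/(_ _ eps0) [N _ /(_ N (leqnn _))] := cTe.
rewrite /= sub0r normrN => /ltW TeN.
have -> : T x = T (e N) - series v N by rewrite sv opprB addrC subrK.
by apply: (le_trans (ler_normB _ _)); rewrite lerD.
Qed.

End ClosedGraph.

(** * Restriction of scalars from the complex to the real field *)

(** What the two scalar fields have in common: F is R + j R, where j is a square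
root of - 1 if F is the complex field and j = 0 if F is R, so that both cases
are treated by the same formulas. The map rf_re is only meaningful as the
inverse of rf_emb on nonnegative elements, such as norms. *)
Record real_form (R : realType) (F : numFieldType) := RealForm {
  rf_emb : {rmorphism R -> F};
  rf_re : F -> R;
  rf_j : F;
  rf_emb_le : {mono rf_emb : x y / x <= y};
  rf_emb_re : forall c, 0 <= c -> rf_emb (rf_re c) = c;
  rf_jP : rf_j = 0 \/ rf_j * rf_j = -1;
  rf_dec : forall c, exists a b, c = rf_emb a + rf_j * rf_emb b }.

Lemma real_form_exists (R : realType) (F : numFieldType) :
  F = R :> numFieldType \/ F = R[i]%C :> numFieldType ->
  inhabited (real_form R F).
Proof.
case=> ->; constructor.
  apply: (@RealForm R R idfun id 0) => //; first by left.
  by move=> c; exists c, 0; rewrite mul0r addr0.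
apply: (@RealForm R R[i]%C (real_complex R) (@complex.Re R) 'i%C).
- by move=> x y; rewrite lecR.
- by move=> c c0; exact: (RRe_real (ger0_real c0)).
- by right; rewrite -expr2 sqr_i.
- by move=> c; exists (complex.Re c), (complex.Im c); exact: complexE.
Qed.

Section RealForm.
Variables (R : realType) (F : numFieldType) (rf : real_form R F).
Local Notation emb := (rf_emb rf).
Local Notation re := (rf_re rf).

Lemma emb_lt x y : (emb x < emb y) = (x < y).
Proof. exact: leW_mono (rf_emb_le rf) x y. Qed.

Lemma emb_ge0 x : (0 <= emb x) = (0 <= x).
Proof. by rewrite -(rmorph0 emb) (rf_emb_le rf). Qed.

Lemma norm_emb x : `|emb x| = emb `|x|.
Proof.
have [x0|x0] := leP 0 x; first by rewrite !ger0_norm // emb_ge0.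
rewrite ltr0_norm; first by rewrite ltr0_norm // rmorphN.
by rewrite -(rmorph0 emb) emb_lt.
Qed.

Lemma emb_inj : injective emb.
Proof. exact: fmorph_inj. Qed.

(** An alias, so that V can carry its structure over R next to the one over F. *)
Definition real_of (V : lmodType F) : Type := V.

Section RealOfLmod.
Variable V : lmodType F.
HB.instance Definition _ := GRing.Zmodule.copy (real_of V) V.
Definition real_scale (a : R) (x : real_of V) : real_of V := emb a *: (x : V).
Lemma real_scaleA a b x : real_scale a (real_scale b x) = real_scale (a * b) x.
Proof. by rewrite /real_scale scalerA rmorphM. Qed.
Lemma real_scale1 : left_id 1 real_scale.
Proof. by move=> x; rewrite /real_scale rmorph1 scale1r. Qed.
Lemma real_scaleDr : right_distributive real_scale +%R.
Proof. by move=> a x y; exact: scalerDr. Qed.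
Lemma real_scaleDl x : {morph real_scale^~ x : a b / a + b}.
Proof. by move=> a b; rewrite /real_scale rmorphD; exact: scalerDl. Qed.
HB.instance Definition _ := GRing.Zmodule_isLmodule.Build R (real_of V)
  real_scaleA real_scale1 real_scaleDr real_scaleDl.
End RealOfLmod.

Section RealOfNormed.
Variable V : normedModType F.
Definition real_norm (x : real_of V) : R := re `|x : V|.
Lemma emb_norm (x : V) : emb (real_norm x) = `|x|.
Proof. exact: rf_emb_re. Qed.
Lemma real_normD x y : real_norm (x + y) <= real_norm x + real_norm y.
Proof. by rewrite -(rf_emb_le rf) rmorphD /= !emb_norm; exact: ler_normD. Qed.
Lemma real_normZ a x : real_norm (a *: x) = `|a| * real_norm x.
Proof.
apply: emb_inj; rewrite rmorphM /= -norm_emb.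
by rewrite emb_norm emb_norm; exact: normrZ.
Qed.
Lemma real_norm0_eq0 x : real_norm x = 0 -> x = 0.
Proof.
by move=> /(congr1 emb); rewrite emb_norm rmorph0 => /normr0_eq0.
Qed.
HB.instance Definition _ := @Lmodule_isNormed.Build R (real_of V)
  real_norm real_normD real_normZ real_norm0_eq0.

Lemma emb_normE (x : real_of V) : emb `|x| = `|x : V|.
Proof. exact: emb_norm. Qed.
End RealOfNormed.

Lemma real_sub_complete (X : completeNormedModType F) (K : csubspace X)
    (G : set_system (real_of (cssort K))) :
  ProperFilter G -> cauchy G -> cvg G.
Proof.
move=> PG /cauchyP Gc.
have re_gt0 (e : F) : 0 < e -> 0 < re e.
  by move=> e0; rewrite -emb_lt rmorph0 rf_emb_re // ltW.
pose vl (x : real_of (cssort K)) : X := val (x : cssort K).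
have distE x y : `|vl x - vl y| = emb `|x - y|.
  by rewrite emb_normE /vl -raddfB.
have : cvg (vl @ G).
  apply: cauchy_cvg; apply: cauchy_exP => e e0.
  have [x Gx] := Gc _ (re_gt0 _ e0); exists (vl x).
  apply: (@filterS _ G _ _ (vl @^-1` ball (vl x) e) _ Gx) => y.
  rewrite /= -!ball_normE /ball_ /= distE -emb_lt => /lt_le_trans; apply.
  by rewrite rf_emb_re // ltW.
move=> /cvg_ex[l Gl].
have Kl : csset K l.
  apply: (@closed_cvg _ _ G _ vl (csset K) _ _ l Gl); first by case: (csubspaceP K).
  by apply: nearW => x; exact: (csval_subproof (x : cssort K)).
pose l' : real_of (cssort K) := exist _ l (introT (asboolP _) Kl) : cssort K.
apply/cvg_ex; exists l'.
apply/cvgrPdist_lt => e e0.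
have e0' : 0 < emb e by rewrite -(rmorph0 emb) emb_lt.
move/cvgrPdist_lt : Gl => /(_ _ e0').
by apply: filterS => x; rewrite -[l]/(vl l') distE emb_lt.
Qed.

HB.instance Definition _ (X : completeNormedModType F) (K : csubspace X) :=
  Uniform_isComplete.Build (real_of (cssort K)) (@real_sub_complete X K).

(** The bound is required to be nonnegative, hence real, because F may be only
partially ordered. *)
Definition bounded_map (V W : normedModType F) (f : V -> W) :=
  exists2 C : F, 0 <= C & forall x, `|f x| <= C * `|x|.

(** The distance to M is sublinear, and positive at v because M is closed. A
real functional g below it that takes the same value at v vanishes on M, and
f x = g x - j g (j x) is its F-linear companion. *)
Lemma separating_functional (X : normedModType F) (M : csubspace X) (v : X) :
  ~ csset M v -> exists f : {scalar X},
  [/\ bounded_map (f : X -> F^o), forall x, csset M x -> f x = 0 & f v <> 0].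
Proof.
move=> nMv; have [M0 MP Mcl] := csubspaceP M.
pose Xr : normedModType R := real_of X.
pose p (x : Xr) : R := inf [set `|x - m| | m in (csset M : set Xr)].
have ple (x m : Xr) : csset M m -> p x <= `|x - m|.
  by move=> Mm; apply: ge_inf; [exists 0 => _ [? _ <-]|exists m].
have pge (x : Xr) c : (forall m : Xr, csset M m -> c <= `|x - m|) -> c <= p x.
  by move=> h; apply: lb_le_inf => [|_ [m Mm <-]]; [exists `|x - 0|, 0|exact: h].
have ps : sublinear p.
  split=> [x y|t x t0].
    rewrite -lerBlDr; apply: (pge) => m Mm; rewrite lerBlDr [leRHS]addrC -lerBlDr.
    apply: (pge) => n Mn; rewrite lerBlDr.
    apply: (le_trans (ple _ (m + n) _)).
      by have := MP 1 m n Mm Mn; rewrite scale1r.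
    by rewrite opprD addrACA [leRHS]addrC ler_normD.
  rewrite -ler_pdivrMl //; apply: (pge) => m Mm; rewrite ler_pdivrMl //.
  apply: (le_trans (ple _ (t *: m) _)).
    by have := MP (emb t) m 0 Mm M0; rewrite addr0.
  by rewrite -scalerBr normrZ gtr0_norm.
have pv : 0 < p v.
  have /nbhs_ballP[e /= e0 eM] : nbhs v (~` csset M).
    by apply: open_nbhs_nbhs; split=> //; exact: closed_openC.
  have re0 : 0 < re e by rewrite -emb_lt rmorph0 rf_emb_re // ltW.
  apply: (lt_le_trans re0); apply: (pge) => m Mm; rewrite leNgt; apply/negP => vm.
  apply: (eM m) Mm; rewrite -ball_normE /ball_ /=.
  by rewrite -(rf_emb_re rf (ltW e0)) -(emb_norm (v - m)) emb_lt.
have [g [gp gv]] := @hahn_banach R Xr p v ps.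
have gn (x : Xr) : `|g x| <= `|x|.
  have pn y : p y <= `|y| by have := ple y 0 M0; rewrite subr0.
  rewrite ler_norml (le_trans (gp x)) // andbT lerNl -raddfN.
  by apply: (le_trans (gp _)); rewrite -[leRHS]normrN.
have gM (x : Xr) : csset M x -> g x = 0.
  have gM0 (y : Xr) : csset M y -> g y <= 0.
    by move=> My; have := le_trans (gp y) (ple y y My); rewrite subrr normr0.
  move=> Mx; apply/eqP; rewrite eq_le gM0 //= -oppr_le0 -raddfN gM0 //.
  by have := MP (-1) x 0 Mx M0; rewrite scaleN1r addr0.
pose j := rf_j rf.
pose f (x : X) : F := emb (g x) - j * emb (g (j *: x)).
have gZ a (x : X) : g (emb a *: x) = a * g x by exact: (scalarZ g a (x : Xr)).
have fl : scalar f.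
  move=> c x y; have [a [b ->]] := rf_dec rf c; rewrite -/j /f.
  have gD (x1 x2 : X) : g (x1 + x2) = g x1 + g x2 by exact: (raddfD g x1 x2).
  have gZj (x1 : X) : emb (g (j *: (j *: x1))) = j * j * emb (g x1).
    rewrite scalerA /j; case: (rf_jP rf) => ->.
      by rewrite !mul0r scale0r (raddf0 g) rmorph0.
    by rewrite scaleN1r (raddfN g) rmorphN mulN1r.
  have cE (x1 : X) : (emb a + j * emb b) *: x1 = emb a *: x1 + emb b *: (j *: x1).
    by rewrite scalerDl scalerA [j * _]mulrC.
  have jcE : j *: (emb a *: x + emb b *: (j *: x)) =
      emb a *: (j *: x) + emb b *: (j *: (j *: x)).
    by rewrite scalerDr !scalerA; congr (_ *: _ + _ *: _); ring.
  rewrite cE [j *: (_ + y)]scalerDr jcE !gD !gZ !rmorphD !rmorphM /= gZj.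
  have [j0|jj] := (rf_jP rf : j = 0 \/ j * j = -1); last by ring: jj.
  have g0 : g (0 : X) = 0 by exact: (raddf0 g).
  by rewrite !j0 !scale0r g0 rmorph0; ring.
have fb : bounded_map (f : X -> F^o).
  exists (1 + `|j| * `|j|) => [|x]; first by rewrite addr_ge0 // mulr_ge0.
  rewrite mulrDl mul1r -mulrA -normrZ.
  have gb (y : X) : `|emb (g y)| <= `|y|.
    by rewrite norm_emb -[leRHS]emb_norm (rf_emb_le rf); exact: gn.
  apply: (le_trans (ler_normB _ _)); rewrite lerD ?gb // normrM.
  by rewrite ler_wpM2l // gb.
pose f' : {scalar X} := HB.pack f (GRing.isLinear.Build _ _ _ _ _ fl).
exists f'; split=> //.
  move=> x Mx; rewrite /= /f !gM // ?rmorph0 ?mulr0 ?subr0 //.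
  by have := MP j x 0 Mx M0; rewrite addr0.
move=> /= /eqP; rewrite /f subr_eq0 => /eqP fv.
suff gv0 : g v = 0 by rewrite -gv gv0 ltxx in pv.
have [j0|jj] := (rf_jP rf : j = 0 \/ j * j = -1).
  by apply: emb_inj; rewrite fv j0 mul0r rmorph0.
(* f v = 0 reads g v = j g (j v), whose square is a sum of two squares equal
   to zero *)
have : g v * g v + g (j *: v) * g (j *: v) = 0.
  apply: emb_inj; rewrite rmorphD !rmorphM rmorph0 /= fv; ring: jj.
by move=> h; nra.
Qed.

(** If u_n -> 0 and T u_n -> w, then f w = lim f (T u_n) = 0 for each f in Phi
by the two bounds, so w = 0: the graph of T is closed. *)
Lemma weakly_bounded_map (X : completeNormedModType F) (K : csubspace X)
    (Phi : set {scalar X}) (T : {linear cssort K -> cssort K}) :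
  (forall f, Phi f -> bounded_map (f : X -> F^o) /\
     bounded_map ((fun v => f (val (T v))) : cssort K -> F^o)) ->
  (forall v : cssort K, (forall f, Phi f -> f (val v) = 0) -> v = 0) ->
  bounded_map (T : cssort K -> cssort K).
Proof.
move=> PhiT sep; pose U : completeNormedModType R := real_of (cssort K).
have Tlin : linear (T : U -> U) by move=> a x y; exact: (linearP T).
pose TR : {linear U -> U} := HB.pack (T : U -> U) (GRing.isLinear.Build _ _ _ _ _ Tlin).
have [|M hM] := @closed_graph_bounded R U U TR; last first.
  exists `|emb M| => // x; rewrite -(emb_norm x) -(emb_norm (T x)).
  rewrite norm_emb -rmorphM (rf_emb_le rf); apply: le_trans (hM x) _.
  by rewrite ler_wpM2r // ler_norm.
move=> u w u0 Tu; apply: sep => f /PhiT[[C C0 fC] [D D0 fTD]].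
have nE (x : U) : emb `|x| = `|val (x : cssort K)| := emb_normE x.
pose B := re C + re D.
have fw n : re `|f (val (w : cssort K))| <= B * (`|w - TR (u n)| + `|u n|).
  rewrite -(rf_emb_le rf) rf_emb_re // rmorphM !rmorphD /= !nE !rf_emb_re //.
  have -> : f (val (w : cssort K)) =
      f (val ((w : cssort K) - T (u n))) + f (val (T (u n))).
    by rewrite -raddfD -raddfD subrK.
  rewrite (le_trans (ler_normD _ _)) // mulrDr lerD //.
    by apply: (le_trans (fC _)); rewrite ler_wpM2r // lerDl.
  by apply: (le_trans (fTD _)); rewrite ler_wpM2r // lerDr.
have fw0 : re `|f (val (w : cssort K))| <= 0.
  have cB : (fun n => B * (`|w - TR (u n)| + `|u n|)) @ \oo --> B * (0 + 0).
    apply: cvgM; first exact: cvg_cst.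
    apply: cvgD; last by rewrite -(normr0 U); exact: cvg_norm.
    rewrite -(normr0 U) -(subrr w); apply: cvg_norm.
    by apply: cvgB Tu; exact: cvg_cst.
  rewrite addr0 mulr0 in cB.
  rewrite -(cvg_lim _ cB) //; apply: limr_ge; first exact: cvgP cB.
  exact: nearW.
apply/eqP; rewrite -normr_le0 -(rf_emb_re rf (normr_ge0 _)).
by rewrite -(rmorph0 emb) (rf_emb_le rf).
Qed.

End RealForm.

(** * Lie identities on rank one operators, in pure linear algebra *)

(** Here G y and H y stand for the values at y (x) f0 and y (x) f of a map psi
from rank one operators to endomorphisms, and the last two hypotheses are the
Lie identity for the pairs (x (x) f0, y (x) f0) and (x (x) f, y (x) f0). Such a psi
is inner up to a multiple of the trace; the normalisation G y x0 = 0 excludes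
the inner part and the multiple of the trace as far as G is concerned, and
then H can only be v |-> f0 v kappa(y) x0 - kappa(v) y, which the identity
rules out too. *)
Lemma rank_one_rigidity (F : numFieldType) (V : lmodType F) (x0 : V)
    (f0 f : {scalar V}) (G H : V -> V -> V) :
  f0 x0 = 1 ->
  (forall y c v, H y (c *: v) = c *: H y v) ->
  (forall y c v, G y (c *: v) = c *: G y v) ->
  (forall y, G y x0 = 0) ->
  (forall x y v, f0 y *: G x v - f0 x *: G y v =
     G x (f0 v *: y) - f0 (G x v) *: y - (G y (f0 v *: x) - f0 (G y v) *: x)) ->
  (forall x y v, f y *: G x v - f0 x *: H y v =
     H x (f0 v *: y) - f0 (H x v) *: y - (G y (f v *: x) - f (G y v) *: x)) ->
  forall y v, H y v = 0.
Proof.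
move=> f0x0 HZ GZ Gx0 eGG eHG.
have half (W : lmodType F) (w : W) : w = - w -> w = 0.
  move=> /eqP; rewrite -subr_eq0 opprK -mulr2n -scaler_nat scaler_eq0 pnatr_eq0.
  by move=> /eqP.
pose simp0 := (scale0r, scaler0, @scale1r F V, subr0, sub0r, addr0, add0r, oppr0).
have G0 y : G x0 y = 0.
  by have := eGG x0 y x0; rewrite !GZ !Gx0 f0x0 !raddf0 !simp0 => <-.
have GE y v : G y v = 0.
  have := eGG x0 y v; rewrite !G0 f0x0 GZ Gx0 !raddf0 !simp0 opprK => e.
  have f0G : f0 (G y v) = 0.
    apply: (half F^o); have := congr1 f0 e.
    by rewrite raddfN scalarZ f0x0 mulr1 => /esym.
  by apply: oppr_inj; rewrite e f0G scale0r oppr0.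
have eH x y v : f0 (H x v) *: y = f0 v *: H x y + f0 x *: H y v.
  have := eHG x y v; rewrite !GE !HZ !raddf0 !simp0 => e.
  by rewrite -[f0 x *: _]opprK e opprB addrC subrK.
have H00 : H x0 x0 = 0.
  have := eH x0 x0 x0; rewrite f0x0 !scale1r => e.
  have k0 : f0 (H x0 x0) = 0.
    have := congr1 f0 e; rewrite scalarZ f0x0 mulr1 raddfD => /eqP.
    by rewrite -subr_eq subrr => /eqP.
  by apply: half; apply/eqP; rewrite -addr_eq0 -e k0 scale0r.
pose kappa x := f0 (H x x0).
have Hx0 x : H x x0 = kappa x *: x0.
  by have := eH x x0 x0; rewrite H00 scaler0 addr0 f0x0 scale1r.
have H0x y : H x0 y = - (kappa y *: x0).
  have := eH x0 y x0; rewrite H00 raddf0 scale0r f0x0 !scale1r Hx0 => /esym/eqP.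
  by rewrite addr_eq0 => /eqP.
have HE y v : H y v = (f0 v * kappa y) *: x0 - kappa v *: y.
  have := eH x0 y v; rewrite f0x0 scale1r !H0x (raddfN f0) /= scalarZ f0x0 mulr1.
  by rewrite scaleNr scalerN scalerA => ->; rewrite addNKr.
have kappa0 x : kappa x = 0.
  have [//|kx] := eqVneq (kappa x) 0.
  have e : x - f0 x *: x0 = 0.
    apply: (scalerI kx); rewrite scaler0; apply: half.
    have := eH x x x0; rewrite -/(kappa x) f0x0 scale1r HE !Hx0 scalerA.
    rewrite scalerBr scalerA opprB [kappa x * _]mulrC.
    by move=> /eqP; rewrite -subr_eq => /eqP.
  have := H0x x; move/eqP: e; rewrite subr_eq0 => /eqP {1}->.
  rewrite HZ H00 scaler0 => /esym/eqP; rewrite oppr_eq0 scaler_eq0 (negPf kx) /=.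
  by move=> /eqP x00; move: f0x0; rewrite x00 raddf0 => /eqP; rewrite eq_sym oner_eq0.
by move=> y v; rewrite HE !kappa0 mulr0 !scale0r subr0.
Qed.

(** The Lie identity for a pair of rank one operators, satisfied by the values
a, is inherited by psi = a - [T, -] - al tr. It is stated after applying an
arbitrary functional h, so that it becomes an identity between scalars. *)
Lemma commutator_correction (F : numFieldType) (V : lmodType F)
    (f g h : {scalar V}) (T axf axg ayf ayg : {linear V -> V}) (al : F) (x y v : V) :
  let psi (k : {scalar V}) (a : V -> V) u w :=
    a w - k w *: T u + k (T w) *: u - (al * k u) *: w in
  f y *: axg v - g x *: ayf v =
    axf (g v *: y) - g (axf v) *: y - (ayg (f v *: x) - f (ayg v) *: x) ->
  h (f y *: psi g axg x v - g x *: psi f ayf y v) =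
    h (psi f axf x (g v *: y) - g (psi f axf x v) *: y -
       (psi g ayg y (f v *: x) - f (psi g ayg y v) *: x)).
Proof.
move=> psi /(congr1 h); rewrite /psi.
have kD (k : {scalar V}) u w : k (u + w) = k u + k w by exact: raddfD.
have kN (k : {scalar V}) u : k (- u) = - k u by exact: raddfN.
have kZ (k : {scalar V}) c u : k (c *: u) = c * k u by exact: scalarZ.
have aZ (a : {linear V -> V}) c u : a (c *: u) = c *: a u by exact: linearZ.
rewrite !(aZ T, aZ axf, aZ ayg) !(kD, kN, kZ) => /eqP; rewrite -subr_eq0 => /eqP e.
by apply/eqP; rewrite -subr_eq0 -[X in _ == X]e; apply/eqP; ring.
Qed.

(** * Lie derivable maps at zero products, on one member of J(L) *)

Section Operators.
Variables (F : numFieldType) (W : normedModType F).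
Implicit Types (f g : bop W) (u v : W).

Lemma bop_ext f g : (forall v, f v = g v) -> f = g.
Proof. by move=> fg; apply: val_inj; apply/funext. Qed.

Lemma bop0E v : (0 : bop W) v = 0. Proof. by []. Qed.
Lemma bop1E v : (1 : bop W) v = v. Proof. by []. Qed.
Lemma bopBE f g v : (f - g) v = f v - g v. Proof. by []. Qed.
Lemma bopDE f g v : (f + g) v = f v + g v. Proof. by []. Qed.
Lemma bopZE c f v : (c *: f) v = c *: f v. Proof. by []. Qed.
Lemma lieE f g v : lie f g v = f (g v) - g (f v). Proof. by []. Qed.
HB.instance Definition _ f :=
  GRing.isLinear.Build F W W *:%R (bop_fun f) (proj1 (bopP f)).

Lemma bop_lZ f c v : f (c *: v) = c *: f v.
Proof. exact: linearZ. Qed.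

Lemma bop_lB f u v : f (u - v) = f u - f v.
Proof. exact: linearB. Qed.

Lemma bop_bounded f : bounded_map (f : W -> W).
Proof.
have [_ [M fM]] := bopP f; exists `|M| => // x.
have [->|x0] := eqVneq x 0; first by rewrite raddf0 !normr0 mulr0.
have M0 : 0 <= M.
  by have := le_trans (normr_ge0 _) (fM x); rewrite pmulr_lge0 ?normr_gt0.
by rewrite ger0_norm.
Qed.

Lemma bopZl c f g : (c *: f) * g = c *: (f * g).
Proof. exact: bop_ext. Qed.

Lemma bopZr c f g : f * (c *: g) = c *: (f * g).
Proof. by apply: bop_ext => v; rewrite -[LHS]/(f (c *: g v)) linearZ. Qed.

End Operators.

Section RankOne.
Variables (R : realType) (F : numFieldType) (rf : real_form R F).
Variables (X : completeNormedModType F) (LL : set (csubspace X)).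
Hypothesis hLL : J_subspace_lattice LL.
Variables (K : csubspace X) (JK : Jset LL K).
Let LK := Jset_sub JK.
Local Notation V := (cssort K).
Local Notation rho A := (alg_restr A LK).

Lemma alg_ext (A B : alg LL) : (forall v, val A v = val B v) -> A = B.
Proof. by move=> AB; apply: val_inj; apply: val_inj; apply/funext. Qed.

(** The annihilator of K_- in the dual space of X. *)
Definition ann (f : {scalar X}) :=
  bounded_map (f : X -> F^o) /\ forall x, csset (csminus LL K) x -> f x = 0.

Lemma annD f g : ann f -> ann g -> ann (f \+ g).
Proof.
move=> [[C C0 fC] f0] [[D D0 gD] g0]; split; last first.
  by move=> x xK; rewrite /= f0 // g0 // addr0.
exists (C + D) => [|x]; first exact: addr_ge0.
by rewrite mulrDl (le_trans (ler_normD _ _)) // lerD ?fC ?gD.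
Qed.

Lemma csminus_in : LL (csminus LL K).
Proof. by have [[_ _ join _] _] := hLL; apply: join => M []. Qed.

(** Alg L leaves K_- invariant, as K_- is itself a member of L. *)
Lemma ann_comp f (A : alg LL) : ann f -> ann (f \o val A).
Proof.
move=> [[C C0 fC] f0]; split; last first.
  by move=> x xK; rewrite /= f0 //; exact: (algP A csminus_in).
have [D D0 AD] := bop_bounded (val A); exists (C * D) => [|x /=].
  exact: mulr_ge0.
by rewrite (le_trans (fC _)) // -mulrA ler_wpM2l // AD.
Qed.

Lemma csminus_sub M : LL M -> ~ (csset K `<=` csset M) ->
  csset M `<=` csset (csminus LL K).
Proof.
move=> LM KM x Mx; apply: subset_closure; exists [:: (1, x)]; split.
  by move=> p; rewrite inE => /eqP -> /=; exists M.
by rewrite big_seq1 scale1r.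
Qed.

(** A nonzero v in K is not in K_-, because K and K_- meet in 0. *)
Lemma ann_separates (v : V) : (forall f, ann f -> f (val v) = 0) -> v = 0.
Proof.
move=> h; have [//|v0] := eqVneq v 0.
have nv : ~ csset (csminus LL K) (val v).
  move=> Kv; have [_ [_ _ _ /(_ _ JK) meet0]] := hLL.
  have : csset (csmeet [set K; csminus LL K]) (val v).
    by move=> M [|] ->//; exact: csval_subproof.
  by rewrite meet0 => /= v0'; case/eqP: v0; apply: val_inj.
have [f [fb fM fv]] := separating_functional rf nv.
by case: fv; apply: h.
Qed.

Lemma exists_dual_pair : exists (x0 : V) (f0 : {scalar X}),
  ann f0 /\ f0 (val x0) = 1.
Proof.
have [_ Kn0 _] := JK.
have [v v0] : exists v : V, v <> 0.
  apply: contrapT => /forallNP nv; apply: Kn0; apply: csubspace_inj.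
  apply/seteqP; split=> x /= Kx; last by rewrite Kx; case: (csubspaceP K).
  pose x' : V := exist _ x (introT (asboolP _) Kx).
  by have /contrapT/(congr1 val) := nv x'.
have [f [fa fv]] : exists f, ann f /\ f (val v) <> 0.
  apply: contrapT => /forallNP nf; apply: v0; apply: ann_separates => f fa.
  by apply: contrapT => fv; apply: (nf f).
exists ((f (val v))^-1 *: v), f; split=> //.
have -> : val ((f (val v))^-1 *: v) = (f (val v))^-1 *: val v by exact: linearZ.
by rewrite scalarZ mulVf //; exact/eqP.
Qed.

(** A member M of L either contains K, hence the range of x (x) f, or is
contained in K_-, where f vanishes. *)
Lemma rank_one_subproof (x : V) (f : {scalar X}) : ann f ->
  exists A : alg LL, forall v, val A v = f v *: val x.
Proof.
move=> [[C C0 fC] f0].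
have fb : (fun v => f v *: val x) \in @blpred F X.
  apply/asboolP; split.
    by move=> a u w; rewrite raddfD /= scalarZ scalerDl scalerA.
  by exists (C * `|val x|) => v; rewrite normrZ mulrAC ler_wpM2r // fC.
have fL : Bop fb \in algpred LL.
  apply/asboolP => M LM v Mv /=; have [M0 MP _] := csubspaceP M.
  have [KM|KM] := pselect (csset K `<=` csset M).
    by have := MP (f v) _ _ (KM _ (csval_subproof x)) M0; rewrite addr0.
  by rewrite f0 ?scale0r //; exact: csminus_sub Mv.
by exists (exist _ (Bop fb) fL).
Qed.

(** The default value 0 outside the annihilator spares the proof argument. *)
Definition rank_one x f : alg LL :=
  if pselect (ann f) is left fa then sval (cid (rank_one_subproof x fa)) else 0.

Lemma rank_oneE x f v : ann f -> val (rank_one x f) v = f v *: val x.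
Proof.
by move=> fa; rewrite /rank_one; case: pselect => // fa'; case: cid.
Qed.

Lemma rho_rank_one x f (v : V) : ann f -> rho (rank_one x f) v = f (val v) *: x.
Proof. by move=> fa; apply: val_inj; rewrite linearZ /= rank_oneE. Qed.

Lemma rhoM (A B : alg LL) : rho (A * B) = rho A * rho B.
Proof. by apply: bop_ext => v; apply: val_inj. Qed.

Lemma mul_rank_one A x f : ann f -> A * rank_one x f = rank_one (rho A x) f.
Proof.
by move=> fa; apply: alg_ext => v; rewrite /= !rank_oneE // linearZ.
Qed.

Lemma rank_one_mul A x f : ann f -> rank_one x f * A = rank_one x (f \o val A).
Proof.
move=> fa; apply: alg_ext => v; rewrite /= !rank_oneE //; exact: ann_comp.
Qed.

Lemma csvalZ c (v : V) : val (c *: v) = c *: val v.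
Proof. by []. Qed.

Lemma csvalB (u v : V) : val (u - v) = val u - val v.
Proof. by []. Qed.

Lemma csvalD (u v : V) : val (u + v) = val u + val v.
Proof. by []. Qed.

Lemma algZl c (A B : alg LL) : (c *: A) * B = c *: (A * B).
Proof. exact: alg_ext. Qed.

Lemma algZr c (A B : alg LL) : A * (c *: B) = c *: (A * B).
Proof. by apply: alg_ext => v; rewrite -[LHS]/(val A (c *: val B v)) linearZ. Qed.

Lemma val_rho (A : alg LL) (v : V) : val (rho A v) = val A (val v).
Proof. by []. Qed.

Lemma algBE (A B : alg LL) v : val (A - B) v = val A v - val B v.
Proof. by []. Qed.

Lemma algZE c (A : alg LL) v : val (c *: A) v = c *: val A v.
Proof. by []. Qed.

Lemma rhoB (A B : alg LL) : rho (A - B) = rho A - rho B.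
Proof.
apply: bop_ext => v; apply: val_inj; rewrite val_rho algBE.
by rewrite -[X in X - _]val_rho -[X in _ - X]val_rho -raddfB.
Qed.

Lemma rhoZ c (A : alg LL) : rho (c *: A) = c *: rho A.
Proof.
by apply: bop_ext => v; apply: val_inj; rewrite val_rho algZE -val_rho -linearZ.
Qed.

Lemma rho_lie (A B : alg LL) : rho (lie A B) = lie (rho A) (rho B).
Proof. by rewrite /lie rhoB !rhoM. Qed.

Lemma rank_one_linear f a x y : ann f ->
  rank_one (a *: x + y) f = a *: rank_one x f + rank_one y f.
Proof.
move=> fa; apply: alg_ext => v; rewrite /= rank_oneE // linearP /=.
rewrite -[RHS]/(a *: val (rank_one x f) v + val (rank_one y f) v) !rank_oneE //.
Qed.

Lemma lie_rank_one x f y g : ann f -> ann g ->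
  lie (rank_one x f) (rank_one y g) =
  f (val y) *: rank_one x g - g (val x) *: rank_one y f.
Proof.
move=> fa ga; apply: alg_ext => v.
rewrite -[LHS]/(val (rank_one x f) (val (rank_one y g) v) -
  val (rank_one y g) (val (rank_one x f) v)).
rewrite -[RHS]/(f (val y) *: val (rank_one x g) v - g (val x) *: val (rank_one y f) v).
by rewrite !rank_oneE // !scalarZ !scalerA ![g v * _]mulrC ![f v * _]mulrC.
Qed.

Section LieDerivable.
Variable phi : {linear alg LL -> bop V}.
Hypothesis phi_zp : forall A B, A * B = 0 ->
  phi (lie A B) = lie (phi A) (rho B) + lie (rho A) (phi B).
Variables (x0 : V) (f0 : {scalar X}).
Hypotheses (f0a : ann f0) (f0x0 : f0 (val x0) = 1).

(** How far phi is from being a Lie derivation. *)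
Definition lie_defect A B : bop V :=
  phi (lie A B) - lie (phi A) (rho B) - lie (rho A) (phi B).
Local Notation Psi := lie_defect.

Lemma lie_defect_zp A B : A * B = 0 -> Psi A B = 0.
Proof. by move=> /phi_zp e; rewrite /Psi e addrAC addrK subrr. Qed.

Lemma lie_defectC A B : Psi A B = - Psi B A.
Proof.
rewrite /Psi (lieC A) raddfN (lieC (phi A)) (lieC (rho A)).
by rewrite !opprD !opprK addrAC.
Qed.

Lemma lie_defectBl A B C : Psi (A - B) C = Psi A C - Psi B C.
Proof.
rewrite /Psi lieBl !(linearB phi) /= rhoB !lieBl !opprD !opprK.
by rewrite [RHS]addrACA [X in _ = X + _]addrACA.
Qed.

Lemma lie_defectZl c A B : Psi (c *: A) B = c *: Psi A B.
Proof.
have lZl (W : normedModType F) (f g : bop W) : lie (c *: f) g = c *: lie f g.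
  by rewrite /lie bopZl bopZr scalerBr.
have lA : lie (c *: A) B = c *: lie A B by rewrite /lie algZl algZr scalerBr.
have pZ D : phi (c *: D) = c *: phi D by exact: linearZ.
by rewrite /Psi rhoZ lA !pZ !lZl -!scalerBr.
Qed.

Lemma lie_defectBr A B C : Psi A (B - C) = Psi A B - Psi A C.
Proof.
rewrite lie_defectC lie_defectBl opprB [in RHS]lie_defectC [Psi A C]lie_defectC.
by rewrite opprK addrC.
Qed.

Lemma lie_defectZr c A B : Psi A (c *: B) = c *: Psi A B.
Proof. by rewrite lie_defectC lie_defectZl -scalerN -lie_defectC. Qed.

Definition balanced N := forall A B, Psi (A * N) B = Psi A (N * B).

(** The products (AE)((1 - E)B) and (A(1 - E))(EB) are zero, so both sides equal
Psi (A E) (E B). *)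
Lemma balanced_idempotent E : E * E = E -> balanced E.
Proof.
move=> EE A B; transitivity (Psi (A * E) (E * B)).
  apply/eqP; rewrite -subr_eq0 -lie_defectBr lie_defect_zp //.
  by rewrite mulrBr -!mulrA [E * (E * B)]mulrA EE subrr.
apply/eqP; rewrite eq_sym -subr_eq0 -lie_defectBl lie_defect_zp //.
by rewrite mulrBl -!mulrA [E * (E * B)]mulrA EE subrr.
Qed.

Lemma balancedB N M : balanced N -> balanced M -> balanced (N - M).
Proof.
by move=> bN bM A B; rewrite mulrBr mulrBl lie_defectBl lie_defectBr bN bM.
Qed.

Lemma balancedZ c N : balanced N -> balanced (c *: N).
Proof. by move=> bN A B; rewrite algZr algZl lie_defectZl lie_defectZr bN. Qed.

(** If f x <> 0 then x (x) f is a multiple of an idempotent. Otherwise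
x (x) f is a difference of two operators of this kind, after adding x0 to x or
f0 to f. *)
Lemma balanced_rank_one x f : ann f -> balanced (rank_one x f).
Proof.
have rank_oneZ c y g : ann g -> rank_one (c *: y) g = c *: rank_one y g.
  move=> ga; apply: alg_ext => v.
  rewrite -[RHS]/(c *: val (rank_one y g) v) !rank_oneE //.
  by rewrite csvalZ !scalerA mulrC.
have case1 y g : ann g -> g (val y) <> 0 -> balanced (rank_one y g).
  move=> ga /eqP gy; rewrite -[y](scalerKV gy) rank_oneZ //; apply: balancedZ.
  apply: balanced_idempotent; rewrite mul_rank_one //; congr rank_one.
  by rewrite rho_rank_one // csvalZ scalarZ mulVf // scale1r.
have case2 y g : ann g -> g (val x0) <> 0 -> balanced (rank_one y g).
  move=> ga gx0; have [gy|gy] := eqVneq (g (val y)) 0; last exact/case1/eqP.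
  have e : rank_one (y + x0) g - rank_one x0 g = rank_one y g.
    by have := rank_one_linear 1 y x0 ga; rewrite !scale1r => ->; rewrite addrK.
  rewrite -e; apply: balancedB; apply: case1 => //.
  have -> : val (y + x0) = val y + val x0 by exact: raddfD.
  by rewrite raddfD /= gy add0r.
move=> fa; have [fx0|fx0] := eqVneq (f (val x0)) 0; last exact/case2/eqP.
have ff0 := annD fa f0a.
have e : rank_one x (f \+ f0) - rank_one x f0 = rank_one x f.
  apply: alg_ext => v.
  rewrite -[LHS]/(val (rank_one x (f \+ f0)) v - val (rank_one x f0) v).
  by rewrite !rank_oneE //= scalerDl addrK.
rewrite -e; apply: balancedB; apply: case2 => //=.
  by rewrite fx0 add0r f0x0; apply/eqP/oner_neq0.
by rewrite f0x0; apply/eqP/oner_neq0.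
Qed.

Lemma lie_defect1 A : Psi A 1 = - lie (rho A) (phi 1).
Proof.
have rho1 : rho 1 = 1 by apply: bop_ext => v; apply: val_inj.
by rewrite /Psi lie1 raddf0 rho1 lie1 subrr sub0r.
Qed.

(** Being balanced moves N to the other side of 1 from either slot, so
Psi A N = Psi (A N) 1 and, by antisymmetry, Psi A N = Psi (N A) 1; and
Psi C 1 = - [C, phi 1]. *)
Lemma balanced_comm N A : balanced N -> lie (rho (lie A N)) (phi 1) = 0.
Proof.
move=> bN; apply: oppr_inj; rewrite -lie_defect1 oppr0 /lie lie_defectBl bN mulr1.
have := bN 1 A; rewrite mul1r => e.
by rewrite (lie_defectC A) e [X in - X]lie_defectC opprK subrr.
Qed.

(** The operator z = phi 1 commutes with [x0 (x) f0, N] for every rank one N.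
Taking N = x0 (x) f makes x0 an eigenvector of z, and then N = v (x) f0 gives
z v the same eigenvalue. *)
Lemma phi1_scalar v : phi 1 v = f0 (val (phi 1 x0)) *: v.
Proof.
set z := phi 1; set l := f0 _.
have comm N u : balanced N ->
    rho (lie (rank_one x0 f0) N) (z u) = z (rho (lie (rank_one x0 f0) N) u).
  move=> bN; apply/eqP; rewrite -subr_eq0 -lieE.
  by rewrite balanced_comm // bop0E.
have rho_comb a b (A B : alg LL) u :
  rho (a *: A - b *: B) u = a *: rho A u - b *: rho B u by rewrite rhoB !rhoZ bopBE !bopZE.
have zx0 : z x0 = l *: x0.
  apply/eqP; rewrite -subr_eq0; apply/eqP; set w := z x0 - _.
  have f0w : f0 (val w) = 0.
    by rewrite /w csvalB csvalZ raddfB /= scalarZ f0x0 mulr1 subrr.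
  apply: ann_separates => f fa; apply: contrapT => /eqP fw.
  have [c e] : exists c, f (val w) *: z x0 = c *: x0.
    exists (f (val (z w)) - f (val x0) * f0 (val (z w))).
    have := comm _ w (balanced_rank_one x0 fa); rewrite lie_rank_one // f0x0 !rho_comb.
    rewrite !rho_rank_one // f0w !scale1r scale0r scaler0 subr0 scalerBl -scalerA => ->.
    by rewrite linearZ.
  have : f0 (val (f (val w) *: z x0)) = f0 (val (c *: x0)) by rewrite e.
  rewrite !csvalZ !scalarZ f0x0 mulr1 => ec.
  move: e; rewrite -ec -scalerA => /(scalerI fw) e.
  by case/eqP: fw; rewrite /w e subrr; exact: raddf0.
have := comm _ x0 (balanced_rank_one v f0a); rewrite lie_rank_one // f0x0 !rho_comb.
have zB : z (f0 (val v) *: x0 - v) = f0 (val v) *: z x0 - z v.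
  by rewrite bop_lB bop_lZ.
rewrite !rho_rank_one // f0x0 !scale1r -/l zB zx0.
by move=> /addrI /oppr_inj ->.
Qed.

(** Psi A N = Psi (A N) 1 = - [A N, phi 1] = 0, since phi 1 is a scalar. *)
Lemma phi_lie_rank_one A x f : ann f ->
  phi (lie A (rank_one x f)) =
  lie (phi A) (rho (rank_one x f)) + lie (rho A) (phi (rank_one x f)).
Proof.
move=> fa; have := phi1_scalar; move: (f0 _) => l z1.
have := balanced_rank_one x fa A 1; rewrite mulr1 lie_defect1.
have -> : lie (rho (A * rank_one x f)) (phi 1) = 0.
  by apply: bop_ext => v; rewrite lieE !z1 bop_lZ subrr.
rewrite oppr0 /Psi => /esym /eqP; rewrite -addrA -opprD subr_eq0 => /eqP.
exact.
Qed.

(** If phi (y (x) f) = [S, y (x) f] + al f(y), evaluation at y = x0, f = f0 gives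
al, and evaluation at x0 gives S up to a scalar, which is fixed by asking that
f0 (S x0) = 0. *)
Let al : F := f0 (val (phi (rank_one x0 f0) x0)).
Let T (y : V) : V := phi (rank_one y f0) x0 - (al * f0 (val y)) *: x0.

Fact generator_linear : linear T.
Proof.
move=> a x y; rewrite /T rank_one_linear //.
have -> : phi (a *: rank_one x f0 + rank_one y f0) x0 =
    a *: phi (rank_one x f0) x0 + phi (rank_one y f0) x0.
  by rewrite linearP.
have -> : f0 (val (a *: x + y)) = a * f0 (val x) + f0 (val y).
  by rewrite -scalarP.
by rewrite mulrDr scalerDl opprD addrACA scalerBr scalerA mulrCA.
Qed.

(** The difference phi - [T, -] - al tr on the operator y (x) f. *)
Let psi (f : {scalar X}) (y v : V) : V :=
  phi (rank_one y f) v - f (val v) *: T y + f (val (T v)) *: y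
  - (al * f (val y)) *: v.

Lemma phi_rank_oneE f y v : ann f ->
  phi (rank_one y f) v =
  f (val v) *: T y - f (val (T v)) *: y + (al * f (val y)) *: v.
Proof.
move=> fa.
pose Tl : {linear V -> V} := HB.pack T (GRing.isLinear.Build _ _ _ _ _ generator_linear).
pose fV (g : {scalar X}) : {scalar V} := g \o val.
have pZ c D : phi (c *: D) = c *: phi D by exact: linearZ.
have phiBZ a b (A B : alg LL) u :
    phi (a *: A - b *: B) u = a *: phi A u - b *: phi B u.
  by rewrite (linearB phi) !pZ bopBE !bopZE.
have psi_lie g h x' y' v' : ann g -> ann h ->
    g (val y') *: psi h x' v' - h (val x') *: psi g y' v' =
    psi g x' (h (val v') *: y') - h (val (psi g x' v')) *: y' -
    (psi h y' (g (val v') *: x') - g (val (psi h y' v')) *: x').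
  move=> ga ha; apply/eqP; rewrite -subr_eq0; apply/eqP; apply: ann_separates => k ka.
  rewrite csvalB raddfB /=; apply/eqP; rewrite subr_eq0; apply/eqP.
  apply: (@commutator_correction F V (fV g) (fV h) (fV k) Tl (phi (rank_one x' g))
    (phi (rank_one x' h)) (phi (rank_one y' g)) (phi (rank_one y' h)) al x' y' v').
  rewrite -phiBZ -lie_rank_one // phi_lie_rank_one // bopDE !lieE !rho_rank_one //.
  by rewrite opprB.
have psiZ g y' c v' : psi g y' (c *: v') = c *: psi g y' v'.
  have TZ u : T (c *: u) = c *: T u by rewrite -[LHS]/(Tl (c *: u)) linearZ.
  rewrite /psi bop_lZ TZ !csvalZ !scalarZ.
  move: (T y') (T v') (phi _ v') => t1 t2 p.
  by rewrite scalerBr scalerDr scalerBr !scalerA [c * (al * _)]mulrC.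
have psi0 : psi f y v = 0.
  apply: (@rank_one_rigidity F V x0 (fV f0) (fV f) (psi f0) (psi f)) => //.
  - move=> y' ; rewrite /psi f0x0 scale1r.
    have -> : f0 (val (T x0)) = 0.
      by rewrite /T csvalB csvalZ raddfB /= scalarZ f0x0 !mulr1 -/al subrr.
    by rewrite /T scale0r addr0 opprB addrCA subrr addr0 subrr.
  - by move=> x' y' v'; exact: psi_lie.
  - by move=> x' y' v'; exact: psi_lie.
move/eqP: psi0; rewrite subr_eq0 => /eqP <-.
by rewrite [RHS]addrC addrACA subrK subrr addr0.
Qed.

(** Applying f0 to the formula for phi (x0 (x) f) expresses f o T as a
combination of f, f0 and f0 o phi (x0 (x) f), all of which are bounded; the
closed graph theorem does the rest. *)
Lemma generator_bounded : exists S : bop V, forall v, S v = T v.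
Proof.
pose Tl : {linear V -> V} := HB.pack T (GRing.isLinear.Build _ _ _ _ _ generator_linear).
have [|v vann|C C0 TC] := @weakly_bounded_map R F rf X K [set f | ann f] Tl; last first.
- have Sb : T \in @blpred F V.
    by apply/asboolP; split; [exact: generator_linear|exists C => v; exact: TC].
  by exists (Bop Sb).
- exact: ann_separates.
move=> f fa; split; first exact: (proj1 fa).
have [[Cf Cf0 fC] _] := fa; have [[C0 C00 f0C] _] := f0a.
have [D D0 phiD] := bop_bounded (phi (rank_one x0 f)).
pose t := f0 (val (T x0)); pose s := al * f (val x0).
exists (Cf * `|t| + `|s| * C0 + C0 * D) => [|v].
  by rewrite !addr_ge0 // mulr_ge0.
have -> : f (val (Tl v)) =
    f (val v) * t + s * f0 (val v) - f0 (val (phi (rank_one x0 f) v)).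
  rewrite -[Tl v]/(T v) phi_rank_oneE // -/s /t.
  move: (T v) (T x0) => Tv Tx0; rewrite csvalD csvalB !csvalZ.
  by rewrite raddfD raddfB /= !scalarZ f0x0; ring.
have h1 : `|f (val v) * t| <= Cf * `|t| * `|v|.
  by rewrite normrM mulrAC ler_wpM2r // fC.
have h2 : `|s * f0 (val v)| <= `|s| * C0 * `|v|.
  by rewrite normrM -mulrA ler_wpM2l // f0C.
have h3 : `|f0 (val (phi (rank_one x0 f) v))| <= C0 * D * `|v|.
  by apply: (le_trans (f0C _)); rewrite -mulrA ler_wpM2l // phiD.
apply: (le_trans (ler_normB _ _)); rewrite mulrDl lerD //.
by apply: (le_trans (ler_normD _ _)); rewrite mulrDl lerD.
Qed.

(** The Lie identity for A and x (x) f0, evaluated at x0: since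
[A, x (x) f0] = A x (x) f0 - x (x) (f0 o A) has trace zero, the terms in al
cancel and what is left says that (phi A - [S, A]) x is a multiple of x by a
factor independent of x. *)
Lemma inner_mod_scalars (S : bop V) : (forall v, S v = T v) ->
  forall A, exists c, phi A = lie S (rho A) + c *: (1 : bop V).
Proof.
move=> ST A.
(* the evaluated identity, with one variable for each vector and each scalar;
   the functional k turns it into an identity between scalars *)
have ann_comb (k : {scalar V}) (tAx ax tx x atx ax0 fx : V) (t0 s p q r w m : F) :
    (tAx - t0 *: ax + s *: x0) - (p *: tx - q *: x + s *: x0) =
    (fx - r *: x) + ((atx - t0 *: ax + w *: ax0) - (p *: tx - m *: x + w *: ax0)) ->
    k fx = k (tAx - atx + (q + r - m) *: x).
  have kD u v : k (u + v) = k u + k v by exact: raddfD.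
  have kN u : k (- u) = - k u by exact: raddfN.
  have kZ c u : k (c *: u) = c * k u by exact: scalarZ.
  move=> /(congr1 k); rewrite !(kD, kN, kZ) => /eqP; rewrite -subr_eq0 => /eqP e.
  by apply/eqP; rewrite -subr_eq0 -oppr_eq0 -[X in _ == X]e; apply/eqP; ring.
exists (f0 (val (rho A (S x0))) + f0 (val (phi A x0)) - f0 (val (S (rho A x0)))).
apply: bop_ext => x; rewrite bopDE lieE bopZE bop1E.
apply/eqP; rewrite -subr_eq0; apply/eqP; apply: ann_separates => k ka.
rewrite csvalB raddfB /=; apply/eqP; rewrite subr_eq0; apply/eqP.
have fA := ann_comp A f0a.
have bD (f : bop V) u v : f (u + v) = f u + f v by exact: raddfD.
apply: (ann_comb (k \o val : {scalar V}) (S (rho A x)) (rho A x) (S x) x (rho A (S x))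
  (rho A x0) (phi A x) (f0 (val (S x0))) (al * f0 (val (rho A x)))
  (f0 (val (rho A x0))) (f0 (val (rho A (S x0)))) (f0 (val (phi A x0)))
  (al * f0 (val x)) (f0 (val (S (rho A x0))))).
have phiE g y v : ann g -> phi (rank_one y g) v =
    g (val v) *: S y - g (val (S v)) *: y + (al * g (val y)) *: v.
  by move=> ga; rewrite !ST; exact: phi_rank_oneE.
have : phi (lie A (rank_one x f0)) x0 = phi (rank_one (rho A x) f0) x0 -
    phi (rank_one x (f0 \o val A)) x0.
  by rewrite /lie mul_rank_one // rank_one_mul // linearB bopBE.
rewrite phi_lie_rank_one // bopDE !lieE !rho_rank_one // f0x0 scale1r !phiE //.
rewrite f0x0 !scale1r bD bop_lB !bop_lZ /= -!val_rho => <-.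
by [].
Qed.

End LieDerivable.

Theorem lie_derivable_inner (phi : {linear alg LL -> bop V}) :
  (forall A B, A * B = 0 ->
    phi (lie A B) = lie (phi A) (rho B) + lie (rho A) (phi B)) ->
  exists S : bop V, forall A, exists c, phi A = lie S (rho A) + c *: (1 : bop V).
Proof.
move=> phi_zp; have [x0 [f0 [f0a f0x0]]] := exists_dual_pair.
have [S ST] := generator_bounded phi_zp f0a f0x0; exists S.
exact: inner_mod_scalars phi_zp _ _ f0a f0x0 _ ST.
Qed.

Lemma rho_linear : linear (fun A => rho A).
Proof.
move=> c A B; apply: bop_ext => v; apply: val_inj.
by rewrite bopDE bopZE csvalD csvalZ !val_rho.
Qed.

(** * Construction of the generators *)

Section HigherDerivable.
Variable L : nat -> {linear alg LL -> alg LL}.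
Hypothesis L0 : forall A, L 0%N A = A.

Let restriction : {linear alg LL -> bop V} :=
  HB.pack (fun A : alg LL => rho A) (GRing.isLinear.Build _ _ _ _ _ rho_linear).

Lemma rho_sum I (r : seq I) (P : pred I) (E : I -> alg LL) :
  rho (\sum_(i <- r | P i) E i) = \sum_(i <- r | P i) rho (E i).
Proof. exact: (raddf_sum restriction). Qed.

Definition scalar_defect (T : nat -> bop V) n := forall A, exists c,
  rho (L n A) = Delta T n (rho A) + c *: (1 : bop V).

Lemma scalar_defect_eq T T' n : (forall k, (0 < k <= n)%N -> T k = T' k) ->
  scalar_defect T n -> scalar_defect T' n.
Proof. by move=> eT h A; have [c ->] := h A; exists c; rewrite (eq_Delta _ eT). Qed.

Lemma lie_scalar (a b : bop V) c d :
  lie (a + c *: (1 : bop V)) (b + d *: (1 : bop V)) = lie a b.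
Proof.
have c1 (e : F) (g : bop V) : lie g (e *: (1 : bop V)) = 0.
  by rewrite /lie bopZl bopZr mulr1 mul1r subrr.
have sN e : e *: (1 : bop V) = - (- e *: (1 : bop V)) by rewrite scaleNr opprK.
have c1' e (g : bop V) : lie (e *: (1 : bop V)) g = 0 by rewrite lieC c1 oppr0.
by rewrite (sN c) (sN d) lieBl !lieBr !c1 !c1' !subr0.
Qed.

Lemma scalar_defect_lie T i j A B :
  scalar_defect T i -> scalar_defect T j ->
  lie (rho (L i A)) (rho (L j B)) = lie (Delta T i (rho A)) (Delta T j (rho B)).
Proof. by move=> /(_ A)[c ->] /(_ B)[d ->]; rewrite lie_scalar. Qed.

Lemma scalar_defect0 T : scalar_defect T 0.
Proof. by move=> A; exists 0; rewrite L0 Delta0 scale0r addr0. Qed.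

(** The scalars drop out of the commutators, and the Leibniz rule for Delta
sums them up. *)
Lemma lie_sum_Delta T n A B : (forall i, (i <= n)%N -> scalar_defect T i) ->
  \sum_(i < n.+1) lie (rho (L i A)) (rho (L (n - i)%N B)) =
  Delta T n (rho (lie A B)).
Proof.
move=> Tn; rewrite rho_lie Delta_lie; apply: eq_bigr => i _.
by apply: scalar_defect_lie; apply: Tn; rewrite ?leq_subr // -ltnS.
Qed.

(** In the difference of the two Leibniz sums only the extreme terms i = 0 and
i = n survive, the others being insensitive to scalars. *)
Lemma defect_zp T n A B : (0 < n)%N ->
  (forall i, (i < n)%N -> scalar_defect T i) ->
  L n (lie A B) = \sum_(i < n.+1) lie (L i A) (L (n - i)%N B) ->
  let phi C := rho (L n C) - Delta T n (rho C) in
  phi (lie A B) = lie (phi A) (rho B) + lie (rho A) (phi B).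
Proof.
case: n => // n _ Tn LAB phi; rewrite /phi LAB rho_sum rho_lie Delta_lie -sumrB.
rewrite big_ord_recl big_ord_recr /= subn0 subnn !L0 !Delta0 !rho_lie.
rewrite [X in _ + (X + _)]big1 ?add0r => [|i _].
  by rewrite addrC !lieBl !lieBr.
rewrite rho_lie (@scalar_defect_lie T) ?subrr //; apply: Tn.
  by rewrite /bump leq0n add1n ltnS.
by rewrite /bump leq0n add1n subSS ltnS leq_subr.
Qed.

Lemma defect_linear T n : linear (fun A => rho (L n A) - Delta T n (rho A)).
Proof.
move=> c A B.
have DZ (f : bop V) : Delta T n (c *: f) = c *: Delta T n f.
  apply: (Delta_comm T n (s := fun g : bop V => c *: g)) => a b.
  - exact: scalerBr.
  - by rewrite bopZr.
  - by rewrite bopZl.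
rewrite linearP !rho_linear DeltaD DZ opprD addrACA scalerBr.
by [].
Qed.

Hypothesis L_zp : forall n A B, A * B = 0 ->
  L n (lie A B) = \sum_(i < n.+1) lie (L i A) (L (n - i)%N B).

Definition set_at (T : nat -> bop V) n t k := if k == n then t else T k.

Lemma next_generator T n : (0 < n)%N ->
  (forall i, (i < n)%N -> scalar_defect T i) ->
  exists t, scalar_defect (set_at T n t) n.
Proof.
move=> n0 Tn; pose T' := set_at T n 0.
have T'n i : (i < n)%N -> scalar_defect T' i.
  move=> iln; apply: scalar_defect_eq (Tn i iln) => k /andP[_ ki].
  by rewrite /T' /set_at ltn_eqF // (leq_ltn_trans ki).
pose phi A := rho (L n A) - Delta T' n (rho A).
have philin : linear phi by exact: defect_linear.
pose phil : {linear alg LL -> bop V} := HB.pack phi (GRing.isLinear.Build _ _ _ _ _ philin).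
have [|t tE] := @lie_derivable_inner phil.
  by move=> A B AB0; apply: defect_zp => //; exact: L_zp.
exists t => A; have [c phiA] := tE A; exists c.
rewrite Delta_top // -[RHS]addrA [set_at _ _ _ n]/set_at eqxx -phiA /= /phi addrC.
suff -> : Delta (fun k => if k == n then 0 else set_at T n t k) n (rho A) =
  Delta T' n (rho A) by rewrite subrK.
by apply: eq_Delta => k _; rewrite /T' /set_at; case: eqP.
Qed.

(** Dependent choice: U n carries the first n generators, and later steps do
not change them. *)
Theorem generators_exist : exists T, forall n, scalar_defect T n.
Proof.
have /choice[g gP] : forall p : nat * (nat -> bop V), exists t, (0 < p.1)%N ->
    (forall i, (i < p.1)%N -> scalar_defect p.2 i) ->
    scalar_defect (set_at p.2 p.1 t) p.1.
  move=> [n T] /=; have [n0|n0] := posnP n; first by exists 0; rewrite n0.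
  have [h|nh] := pselect (forall i, (i < n)%N -> scalar_defect T i).
    by have [t tn] := next_generator n0 h; exists t.
  by exists 0.
pose fix U n := if n is m.+1 then set_at (U m) n (g (n, U m)) else fun=> 0.
have UP n : forall i, (i <= n)%N -> scalar_defect (U n) i.
  elim: n => [|n IHn] i; first by rewrite leqn0 => /eqP ->; exact: scalar_defect0.
  rewrite leq_eqVlt => /orP[/eqP ->|iln]; first exact: (gP (n.+1, U n)).
  apply: scalar_defect_eq (IHn i iln) => k /andP[_ ki].
  by rewrite /= /set_at ltn_eqF // (leq_ltn_trans ki).
have Ustable n k : (k <= n)%N -> U n k = U k k.
  elim: n => [|n IHn]; first by rewrite leqn0 => /eqP ->.
  rewrite leq_eqVlt => /orP[/eqP -> //|kn].
  by rewrite /= {1}/set_at ltn_eqF // IHn.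
exists (fun k => U k k) => n; apply: scalar_defect_eq (UP n n (leqnn n)) => k.
by move=> /andP[_ kn]; exact: Ustable.
Qed.

End HigherDerivable.

End RankOne.

(** * The characterisation *)

(** The members of J(L) span a dense subspace, and C is continuous. *)
Lemma alg_eq0_of_Jset (F : numFieldType) (X : completeNormedModType F)
    (LL : set (csubspace X)) (C : alg LL) :
  csjoin (Jset LL) = cstop ->
  (forall K, Jset LL K -> forall x, csset K x -> val C x = 0) -> C = 0.
Proof.
move=> joinT CK; apply: alg_ext => x; rewrite -[RHS]/(0 : X).
have [M M0 CM] := bop_bounded (val C).
have span0 y : linear_span (\bigcup_(K in Jset LL) csset K) y -> val C y = 0.
  move=> [s [sJ ->]]; rewrite raddf_sum /= big_seq big1 // => p ps.
  by have [K JK Kp] := sJ p ps; rewrite bop_lZ (CK K JK) // scaler0.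
have xcl : closure (linear_span (\bigcup_(K in Jset LL) csset K)) x.
  by have /(congr1 (fun K : csubspace X => csset K x)) /= -> := joinT.
apply/eqP; rewrite -normr_eq0 -[_ == 0]negbK -normr_gt0 normr_id.
apply/negP => Cx0; have M10 : 0 < M + 1 by rewrite ltr_wpDl.
have [y [/span0 Cy]] := xcl _ (nbhsx_ballx x _ (divr_gt0 Cx0 M10)).
rewrite -ball_normE /ball_ /= ltr_pdivlMr // => xy.
have := CM (x - y); rewrite bop_lB Cy subr0 => /le_lt_trans.
have h : M * `|x - y| <= `|x - y| * (M + 1).
  by rewrite mulrC ler_wpM2l // lerDl.
by move=> /(_ _ (le_lt_trans h xy)); rewrite ltxx.
Qed.

(** Stated apart so that the packaged functional is known only through its
values, never unfolded. *)
Lemma scalar_bundle (F : numFieldType) (V : lmodType F) (f : V -> F) :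
  scalar f -> exists g : {scalar V}, forall x, g x = f x.
Proof.
move=> fs.
pose g : {scalar V} := HB.pack f (GRing.isLinear.Build _ _ _ _ _ fs).
by exists g.
Qed.

Theorem theorem2p8 (R : realType) (F : numFieldType)
    (hF : F = R :> numFieldType \/ F = R[i]%C :> numFieldType)
    (X : completeNormedModType F) (LL : set (csubspace X))
    (hLL : J_subspace_lattice LL)
    (L : nat -> {linear alg LL -> alg LL}) (L0 : forall A, L 0%N A = A) :
  (forall (n : nat) (A B : alg LL), A * B = 0 ->
     L n (lie A B) = \sum_(i < n.+1) lie (L i A) (L (n - i)%N B))
  <->
  (forall (K : csubspace X) (JK : Jset LL K),
     exists (T : nat -> bop (cssort K)) (h : nat -> {scalar alg LL}),
       (forall n : nat, (1 <= n)%N ->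
          forall A B : alg LL, A * B = 0 -> h n (lie A B) = 0) /\
       (forall n : nat, (1 <= n)%N -> forall (A : alg LL) (x : cssort K),
          val (L n A) (val x) =
          val ((Delta T n (alg_restr A (Jset_sub JK))
                + h n A *: (1 : bop (cssort K))) x))).
Proof.
have [_ [joinT _ _ _]] := hLL.
have [rf] := real_form_exists hF.
split=> [L_zp K JK|struct n A B AB0].
  have [T Tn] := generators_exist rf hLL JK L0 L_zp.
  have [x0 [f0 [f0a f0x0]]] := exists_dual_pair rf hLL JK.
  (* defect n A is a scalar operator; its scalar is read off at x0 by f0, which
     makes h n visibly linear in A *)
  pose defect n A := alg_restr (L n A) (Jset_sub JK) - Delta T n (alg_restr A (Jset_sub JK)).
  have defectE n A : defect n A = f0 (val (defect n A x0)) *: (1 : bop (cssort K)).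
    have [c e] := Tn n A.
    have -> : defect n A = c *: (1 : bop (cssort K)) by rewrite /defect e addrAC subrr add0r.
    by rewrite -[X in f0 (val X)]/(c *: x0) csvalZ scalarZ f0x0 mulr1.
  have hlin n : scalar (fun A => f0 (val (defect n A x0))).
    move=> c A B; have -> : defect n (c *: A + B) = c *: defect n A + defect n B.
      exact: defect_linear.
    rewrite bopDE bopZE csvalD csvalZ.
    by rewrite raddfD /= scalarZ.
  have /choice[h hE] : forall n, exists g : {scalar alg LL},
      forall A, g A = f0 (val (defect n A x0)).
    by move=> n; apply: scalar_bundle; exact: hlin.
  exists T, h; split=> n n0.
    move=> A B AB0; rewrite hE.
    have -> : defect n (lie A B) = 0.
      rewrite /defect L_zp // rho_sum -(lie_sum_Delta (L := L) (T := T)) // -sumrB big1 // => i _.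
      by rewrite rho_lie subrr.
    by rewrite bop0E (raddf0 f0).
  move=> A x; rewrite -[LHS]/(val (alg_restr (L n A) (Jset_sub JK) x)); congr val.
  by rewrite hE -defectE /defect addrC subrK.
apply/eqP; rewrite -subr_eq0; apply/eqP; apply: alg_eq0_of_Jset => // K JK x Kx.
have [T [h [h0 LE]]] := struct K JK.
have LD m A' : (0 < m)%N -> alg_restr (L m A') (Jset_sub JK) =
    Delta T m (alg_restr A' (Jset_sub JK)) + h m A' *: (1 : bop (cssort K)).
  by move=> m0; apply: bop_ext => v; apply: val_inj; exact: LE.
have Tdef m : scalar_defect JK L T m.
  case: m => [|m]; first exact: scalar_defect0.
  by move=> A'; exists (h m.+1 A'); exact: LD.
have [n0|n0] := posnP n.
  by rewrite n0 big_ord1 !L0 subrr.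
have rho0 : alg_restr (L n (lie A B) - \sum_(i < n.+1) lie (L i A) (L (n - i)%N B))
    (Jset_sub JK) = 0.
  rewrite rhoB rho_sum; under eq_bigr do rewrite rho_lie.
  by rewrite (lie_sum_Delta (L := L) (T := T)) // LD // h0 // scale0r addr0 subrr.
move: (_ - _) rho0 => C C0; pose x' : cssort K := exist _ x (introT (asboolP _) Kx).
by rewrite -[x]/(val x') -(val_rho JK C x') C0 bop0E.
Qed.
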